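(* Suppose the weighted graph $\mathcal{G}$ is connected and symmetric and the interpolation function $\theta$ satisfies (A1)–(A7). Then $D_{\mathbb{R}^d\times\mathcal{G}}$ is a semimetric on $\mathcal{P}_2(\mathbb{R}^d\times\mathcal{G})$, that is, $(\boldsymbol{\mu},\boldsymbol{\nu})\mapsto D_{\mathbb{R}^d\times\mathcal{G}}(\boldsymbol{\mu},\boldsymbol{\nu})$ is a nonnegative, symmetric, finitely valued function that vanishes only when $\boldsymbol{\mu}=\boldsymbol{\nu}$.
   Context: Graph. $\mathcal{G}$ is a weighted graph with nodes $\{1,\dots,n\}$ and edge weights $q_{ij}\ge 0$. It is symmetric if $q_{ij}=q_{ji}$ and connected if any two nodes are joined by a finite sequence of edges with strictly positive weights. Interpolation function. Assumptions on $\theta:[0,\infty)\times[0,\infty)\to[0,\infty)$: (A1) $\theta$ is continuous on $[0,\infty)^2$ and $C^\infty$ on $(0,\infty)^2$; (A2) $\theta(t,s)=\theta(s,t)$; (A3) $\theta>0$ on $(0,\infty)^2$; (A4) $\theta(1,1)=1$; (A5) $\theta(r,t)\le\theta(s,t)$ for $t\ge0$, $0\le r\le s$; (A6) $\theta(\lambda t,\lambda s)=\lambda\theta(t,s)$ for $\lambda>0$, $t,s\ge0$; (A7) $\theta$ is concave. Vector valued measures. $\mathcal{P}(\mathbb{R}^d\times\mathcal{G})$ is the set of $\boldsymbol{\mu}=[\mu_1,\dots,\mu_n]^t$ with $\mu_i$ finite nonnegative Borel measures on $\mathbb{R}^d$ and $\sum_i\mu_i(\mathbb{R}^d)=1$;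 $\mathcal{P}_2(\mathbb{R}^d\times\mathcal{G})$ is the subset with $\int|x|^2d\mu_i<\infty$ for all $i$. Graph Wasserstein metric. $\mathcal{P}(\mathcal{G})=\{p\in\mathbb{R}^n:p_i\ge0,\sum_ip_i=1\}$. A pair $(p,v)$ solves the graph continuity equation on $[0,1]$ if $p:[0,1]\to\mathcal{P}(\mathcal{G})$ is continuous, $v:[0,1]\to\mathbb{R}^{n\times n}$ is measurable, $t\mapsto\theta(p_{i,t},p_{j,t})v_{ij,t}$ is locally integrable on $(0,1)$ for all $i,j$, and $\partial_tp_i=\frac12\sum_j\theta(p_i,p_j)(v_{ij}-v_{ji})q_{ij}$ in the sense of distributions for all $i$. Then $W_\mathcal{G}^2(p_0,p_1)$ is the infimum of $\int_0^1\frac12\sum_{i,j}v_{ij,t}^2\theta(p_{i,t},p_{j,t})q_{ij}\,dt$ over all such $(p,v)$ with endpoints $p_0,p_1$. Lifted space. $\Delta^{n-1}=\{r\in\mathbb{R}^{n-1}:r_i\ge0,\ \sum_{i}r_i\le1\}$, $\mathbf{p}(r)=[p_j(r)]_{j=1}^n:=[r_1,\dots,r_{n-1},1-\sum_{i=1}^{n-1}r_i]\in\mathcal{P}(\mathcal{G})$, $d_{\Delta^{n-1}}(r,\tilde r):=W_\mathcal{G}(\mathbf{p}(r),\mathbf{p}(\tilde r))$, and $d^2_{\mathbb{R}^d\times\Delta^{n-1}}((x,r),(\tilde x,\tilde r)):=|x-\tilde x|^2+d^2_{\Delta^{n-1}}(r,\tilde r)$. $W_{\mathbb{R}^d\times\Delta^{n-1}}$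 is the 2-Wasserstein (Kantorovich) distance on probability measures on $\mathbb{R}^d\times\Delta^{n-1}$ with ground distance $d_{\mathbb{R}^d\times\Delta^{n-1}}$. The projection $\mathfrak{P}:\mathcal{P}(\mathbb{R}^d\times\Delta^{n-1})\to\mathcal{P}(\mathbb{R}^d\times\mathcal{G})$ is given by $\int\eta\,d(\mathfrak{P}\lambda)_j=\int p_j(r)\eta(x)\,d\lambda(x,r)$ for all bounded continuous $\eta$, $j=1,\dots,n$. Definition. $D_{\mathbb{R}^d\times\mathcal{G}}(\boldsymbol{\mu},\boldsymbol{\nu}):=\inf\{W_{\mathbb{R}^d\times\Delta^{n-1}}(\lambda_1,\lambda_2):\mathfrak{P}\lambda_1=\boldsymbol{\mu},\ \mathfrak{P}\lambda_2=\boldsymbol{\nu}\}$. *)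

(* Defs.v *)
From HB Require Import structures.
From mathcomp Require Import all_boot all_order all_algebra.
From mathcomp Require Import all_classical all_reals all_analysis.

Set Implicit Arguments.
Unset Strict Implicit.
Unset Printing Implicit Defensive.

Import Order.TTheory GRing.Theory Num.Theory.
Import numFieldNormedType.Exports.

Local Open Scope classical_set_scope.
Local Open Scope ring_scope.

Notation borel T := (g_sigma_algebraType (@open T)).

(* The library norm on 'rV[R]_d is the sup norm; this is the Euclidean one. *)
Definition enorm (R : realType) (d : nat) (x : 'rV[R]_d) : R :=
  Num.sqrt (\sum_(i < d) x 0 i ^+ 2).

(* For D open in a finite-dimensional V, ranging over all directions v amounts
   to ranging over the partial derivatives; 'D_v f is only used near D. *)
Fixpoint Ck_on (R : realType) (V : normedModType R) (D : set V) (k : nat)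
    (f : V -> R^o) : Prop :=
  if k is k'.+1 then
    (forall x v, D x -> derivable f x v) /\ (forall v, Ck_on D k' ('D_v f))
  else {in D, continuous f}.

Definition smooth_on (R : realType) (V : normedModType R) (D : set V)
  (f : V -> R^o) : Prop := forall k, Ck_on D k f.

(* theta is total on R * R, but only its values on [0, +oo[ ^ 2 matter. *)
Record interpolation_function (R : realType) (theta : R -> R -> R) : Prop := {
  theta_ge0 : forall s t, 0 <= s -> 0 <= t -> 0 <= theta s t ;
  theta_continuous : {within [set x : R^o * R^o | 0 <= x.1 /\ 0 <= x.2],
    continuous (fun x => theta x.1 x.2)} ;
  theta_smooth : smooth_on [set x : (R^o * R^o)%type | 0 < x.1 /\ 0 < x.2]
    (fun x => theta x.1 x.2) ;
  theta_sym : forall s t, 0 <= s -> 0 <= t -> theta s t = theta t s ;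
  theta_gt0 : forall s t, 0 < s -> 0 < t -> 0 < theta s t ;
  theta11 : theta 1 1 = 1 ;
  theta_nondecreasing : forall r s t, 0 <= t -> 0 <= r -> r <= s ->
    theta r t <= theta s t ;
  theta_homogeneous : forall l s t, 0 < l -> 0 <= s -> 0 <= t ->
    theta (l * t) (l * s) = l * theta t s ;
  theta_concave : forall l s t s' t', 0 <= l -> l <= 1 ->
    0 <= s -> 0 <= t -> 0 <= s' -> 0 <= t' ->
    l * theta s t + (1 - l) * theta s' t' <=
    theta (l * s + (1 - l) * s') (l * t + (1 - l) * t')
}.

(* A weighted graph on n.+1 nodes is its matrix of edge weights. *)
Definition weighted_graph (R : realType) (n : nat) (q : 'M[R]_n.+1) : Prop :=
  forall i j, 0 <= q i j.

Definition symmetric_graph (R : realType) (n : nat) (q : 'M[R]_n.+1) : Prop :=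
  forall i j, q i j = q j i.

Definition connected_graph (R : realType) (n : nat) (q : 'M[R]_n.+1) : Prop :=
  forall i j, connect [rel k l | 0 < q k l] i j.

Definition graph_prob (R : realType) (n : nat) : set 'rV[R]_n.+1 :=
  [set p | (forall i, 0 <= p 0 i) /\ \sum_i p 0 i = 1].

Definition test_function01 (R : realType) (phi : R -> R) : Prop :=
  [/\ smooth_on [set: R^o] phi,
      compact (closure [set t | phi t != 0]) &
      closure [set t | phi t != 0] `<=` `]0, 1[].

Definition graph_continuity_equation (R : realType) (n : nat)
    (theta : R -> R -> R) (q : 'M[R]_n.+1)
    (p : R -> 'rV[R]_n.+1) (v : R -> 'M[R]_n.+1) : Prop :=
  [/\ forall t, t \in `[0, 1] -> graph_prob (p t),
      {within `[0, 1], continuous p},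
      forall i j, measurable_fun (`[0, 1] : set R) (fun t => v t i j),
      forall i j, locally_integrable `]0, 1[
        (fun t => theta (p t 0 i) (p t 0 j) * v t i j) &
      forall i (phi : R -> R), test_function01 phi ->
        - (\int[lebesgue_measure]_(t in `]0, 1[) (p t 0 i * derive1 phi t)) =
        \int[lebesgue_measure]_(t in `]0, 1[)
          (2^-1 * (\sum_j theta (p t 0 i) (p t 0 j) *
                     (v t i j - v t j i) * q i j) * phi t)].

Definition graph_action (R : realType) (n : nat)
    (theta : R -> R -> R) (q : 'M[R]_n.+1)
    (p : R -> 'rV[R]_n.+1) (v : R -> 'M[R]_n.+1) : \bar R :=
  (\int[lebesgue_measure]_(t in `[0%R, 1%R])
    (2^-1 * \sum_i \sum_j
       v t i j ^+ 2 * theta (p t 0%R i) (p t 0%R j) * q i j)%:E)%E.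

Definition W_graph (R : realType) (n : nat)
    (theta : R -> R -> R) (q : 'M[R]_n.+1) (p0 p1 : 'rV[R]_n.+1) : \bar R :=
  sqrte (ereal_inf [set a | exists p v,
    [/\ graph_continuity_equation theta q p v, p 0 = p0, p 1 = p1 &
        a = graph_action theta q p v]]).

Definition simplex_set (R : realType) (n : nat) : set 'rV[R]_n :=
  [set r | (forall i, 0 <= r 0 i) /\ \sum_i r 0 i <= 1].

Definition simplex (R : realType) (n : nat) := set_type (@simplex_set R n).

Lemma simplex_set0 (R : realType) (n : nat) :
  (0 : 'rV[R]_n) \in @simplex_set R n.
Proof.
rewrite inE; split=> [i|]; first by rewrite mxE.
by rewrite big1 ?ler01// => i _; rewrite mxE.
Qed.

(* Subspace topology of the Euclidean topology. *)
HB.instance Definition _ (R : realType) (n : nat) :=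
  Topological.copy (simplex R n) (set_type (@simplex_set R n)).
HB.instance Definition _ (R : realType) (n : nat) :=
  isPointed.Build (simplex R n) (exist _ 0 (simplex_set0 R n)).

(* The last coordinate, of index ord_max, is the dependent one. *)
Definition simplex_prob (R : realType) (n : nat) (r : simplex R n) :
    'rV[R]_n.+1 :=
  \row_j (if unlift ord_max j is Some i then set_val r 0 i
          else 1 - \sum_i set_val r 0 i).

Definition simplex_dist (R : realType) (n : nat)
    (theta : R -> R -> R) (q : 'M[R]_n.+1) (r r' : simplex R n) : \bar R :=
  W_graph theta q (simplex_prob r) (simplex_prob r').

(* The product of Borel sigma-algebras is the Borel sigma-algebra of the
   product, both factors being second countable. *)
Notation lifted_space R d n := (borel 'rV[R]_d * borel (simplex R n))%type.

Definition lifted_dist (R : realType) (d n : nat)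
    (theta : R -> R -> R) (q : 'M[R]_n.+1) (z z' : lifted_space R d n) :
    \bar R :=
  sqrte ((enorm ((z.1 : 'rV[R]_d) - z'.1) ^+ 2)%:E +
         simplex_dist theta q z.2 z'.2 ^+ 2)%E.

Definition is_coupling (R : realType) (disp : measure_display)
    (T : measurableType disp) (l1 l2 : probability T R)
    (g : probability (T * T)%type R) : Prop :=
  forall A, measurable A ->
    g (fst @^-1` A) = l1 A /\ g (snd @^-1` A) = l2 A.

Definition wasserstein2 (R : realType) (disp : measure_display)
    (T : measurableType disp) (dist : T -> T -> \bar R)
    (l1 l2 : probability T R) : \bar R :=
  sqrte (ereal_inf
    [set (\int[g]_z (dist z.1 z.2 ^+ 2))%E | g in is_coupling l1 l2]).

Definition vector_measure (R : realType) (d n : nat) : Type :=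
  'I_n.+1 -> {finite_measure set (borel 'rV[R]_d) -> \bar R}.

Definition vector_prob (R : realType) (d n : nat)
    (mu : vector_measure R d n) : Prop :=
  (\sum_i mu i setT = 1)%E.

Definition vector_prob2 (R : realType) (d n : nat)
    (mu : vector_measure R d n) : Prop :=
  vector_prob mu /\
  forall i, (\int[mu i]_x ((enorm (x : 'rV[R]_d)) ^+ 2)%:E < +oo)%E.

Definition projects_to (R : realType) (d n : nat)
    (l : probability (lifted_space R d n) R) (mu : vector_measure R d n) :
    Prop :=
  forall (j : 'I_n.+1) (eta : 'rV[R]_d -> R^o),
    continuous eta -> bounded_fun eta ->
    (\int[mu j]_x (eta x)%:E =
     \int[l]_z (simplex_prob (z.2) 0%R j * eta z.1)%:E)%E.

Definition D_graph (R : realType) (d n : nat)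
    (theta : R -> R -> R) (q : 'M[R]_n.+1)
    (mu nu : vector_measure R d n) : \bar R :=
  ereal_inf [set w | exists l1 l2 : probability (lifted_space R d n) R,
    [/\ projects_to l1 mu, projects_to l2 nu &
        w = wasserstein2 (lifted_dist theta q) l1 l2]].

(* Main.v *)
(* Everything reduces to two estimates on the graph metric [W = W_graph].

   Lower bound: test the continuity equation of a competitor [(p, v)] against
   smooth plateau functions converging to the indicator of [0, 1].  Since
   [p] is continuous this gives [|p_i(1) - p_i(0)| <= \int |div_i|], and since
   [theta <= 1] on [0, 1]^2, Young's inequality bounds the right-hand side by
   [a A + Q / a] for all [a > 0], [A] being the action and [Q] the total weight.
   Optimizing in [a] yields [|p_i(1) - p_i(0)|^2 <= C W^2].

   Upper bound: [theta s t >= min s t] by monotonicity and homogeneity, so any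
   two points of the simplex are joined through its interior by a polynomial
   curve of bounded action, whose velocity is routed along the edges by unit
   flows given by connectedness.

   Finiteness: couple [\sum_j mu_j \x \d_(e_j)] and [\sum_j nu_j \x \d_(e_j)] by
   their product.  Separation: if [D = 0], the lower bound shows that
   [\int eta d(mu_j) = \int eta d(nu_j)] for every bounded Lipschitz [eta], and
   such functions determine a finite Borel measure.

   The lifted distance is never shown to be measurable: the library integral of
   a nonnegative function is a supremum over the simple functions below it, and
   the few properties needed hold for that lower integral. *)
Require Import Defs.
From HB Require Import structures.
From mathcomp Require Import all_boot all_order all_algebra.
From mathcomp Require Import all_classical all_reals all_analysis.
From mathcomp Require Import measurable_realfun ring lra.

Set Implicit Arguments.
Unset Strict Implicit.
Unset Printing Implicit Defensive.

Import Order.TTheory GRing.Theory Num.Theory.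
Import numFieldNormedType.Exports.

Local Open Scope classical_set_scope.
Local Open Scope ring_scope.

(** * Lower integrals *)

Section lower_integral.
Local Open Scope ereal_scope.
Import HBNNSimple.

(** Neither function is assumed measurable: a simple function below [f] is also below [g], so the
    two suprema compare. *)
Lemma ge0_le_lower_integral d (T : measurableType d) (R : realType)
    (mu : {measure set T -> \bar R}) (D : set T) (f g : T -> \bar R) :
  (forall x, D x -> 0 <= f x) -> (forall x, D x -> f x <= g x) ->
  \int[mu]_(x in D) f x <= \int[mu]_(x in D) g x.
Proof.
move=> f0 fg.
have g0 x : D x -> 0 <= g x by move=> Dx; exact: le_trans (f0 _ Dx) (fg _ Dx).
rewrite !ge0_integralE//; apply: le_ereal_sup => _ [h /= hf <-].
exists h => //= x; apply: (le_trans (hf x)).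
by apply: lee_restrict.
Qed.

Lemma ge0_integral_image_measure d1 d2 (X : measurableType d1)
    (Y : measurableType d2) (R : realType) (phi : X -> Y)
    (mu : {measure set X -> \bar R}) (nu : {measure set Y -> \bar R})
    (f : Y -> \bar R) : measurable_fun setT phi ->
  (forall A, measurable A -> nu A = mu (phi @^-1` A)) ->
  measurable_fun setT f -> (forall y, 0 <= f y) ->
  \int[nu]_y f y = \int[mu]_x f (phi x).
Proof.
move=> mphi nuE mf f0; rewrite (eq_measure_integral (pushforward mu phi))//.
  by rewrite ge0_integral_pushforward// => y _; exact: f0.
by move=> A mA _; rewrite nuE.
Qed.

(** Only one inequality survives without measurability of [f]. A simple function below [f] pulls
    back along [phi] to one below [f \o phi], but not every simple function below [f \o phi] is such
    a pullback. *)
Lemma ge0_lower_integral_image_measure d1 d2 (X : measurableType d1)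
    (Y : measurableType d2) (R : realType) (phi : X -> Y)
    (mu : {measure set X -> \bar R}) (nu : {measure set Y -> \bar R})
    (f : Y -> \bar R) : measurable_fun setT phi ->
  (forall A, measurable A -> nu A = mu (phi @^-1` A)) ->
  (forall y, 0 <= f y) ->
  \int[nu]_y f y <= \int[mu]_x f (phi x).
Proof.
move=> mphi nuE f0; rewrite ge0_integralTE//.
apply: ge_ereal_sup => _ [h /= hf <-].
have <- : \int[nu]_y (h y)%:E = sintegral nu h by exact: integralT_nnsfun.
rewrite (ge0_integral_image_measure mphi nuE).
- by apply: ge0_le_lower_integral => x _ /=; [rewrite lee_fin | exact: hf].
- exact/measurable_EFinP/measurable_funP.
- by move=> y; rewrite lee_fin.
Qed.

(** Since [phi] is its own inverse, the one-sided comparison applied to [f] and to [f \o phi] gives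
    equality for an arbitrary [f]. *)
Lemma integral_involution d (T : measurableType d) (R : realType)
    (mu : {measure set T -> \bar R}) (phi : T -> T) (D : set T)
    (f : T -> \bar R) : measurable_fun setT phi -> involutive phi ->
  (forall A, measurable A -> mu (phi @^-1` A) = mu A) ->
  \int[mu]_(x in D) f x = \int[mu]_(x in phi @^-1` D) f (phi x).
Proof.
move=> mphi phiK muphi.
have ge0 (g : T -> \bar R) : (forall x, 0 <= g x) ->
    \int[mu]_x g x = \int[mu]_x g (phi x).
  move=> g0; apply/eqP; rewrite eq_le; apply/andP; split.
    by apply: ge0_lower_integral_image_measure => // A mA; rewrite muphi.
  have -> : \int[mu]_x g x = \int[mu]_x g (phi (phi x)).
    by apply: eq_integral => x _; rewrite phiK.
  apply: (ge0_lower_integral_image_measure (f := fun x => g (phi x)) mphi) => //.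
  by move=> A mA; rewrite muphi.
have noD (g : T -> \bar R) : \int[mu]_x g x = \int[mu]_x g (phi x).
  rewrite integralE [RHS]integralE.
  rewrite (ge0 (g ^\+)); last by move=> x; exact: funepos_ge0.
  rewrite (ge0 (g ^\-)); last by move=> x; exact: funeneg_ge0.
  by congr (_ - _); apply: eq_integral => x _; rewrite ?funeposE ?funenegE.
rewrite integral_mkcond noD [RHS]integral_mkcond; apply: eq_integral => x _.
by rewrite /patch; congr (if _ then _ else _); apply/asbool_equiv_eq.
Qed.

End lower_integral.

(** * Smooth plateau functions *)

Section flat_function.
Context {R : realType}.
Implicit Types (k : nat) (x : R).

(** The index [k] makes the family stable under differentiation: the derivative of [flat k] is a
    combination of [flat k.+2] and [flat k.+1]. *)
Definition flat k x : R := if 0 < x then x^-1 ^+ k * expR (- x^-1) else 0.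

Lemma flat_ge0 k x : 0 <= flat k x.
Proof.
rewrite /flat; case: ifPn => // x0.
by rewrite mulr_ge0 ?expR_ge0// exprn_ge0// invr_ge0 ltW.
Qed.

Lemma flat_gt0 k x : 0 < x -> 0 < flat k x.
Proof. by move=> x0; rewrite /flat x0 mulr_gt0 ?expR_gt0// exprn_gt0// invr_gt0. Qed.

Lemma flat_le0 k x : x <= 0 -> flat k x = 0.
Proof. by rewrite /flat ltNge => ->. Qed.

(** One term of the exponential series at [x^-1] is kept. The quadratic bound serves to show that
    the derivative at the origin is 0. *)
Lemma flat_le_sqr k x : flat k x <= (k.+2)`!%:R * x ^+ 2.
Proof.
have [x0|x0] := leP x 0; first by rewrite flat_le0// mulr_ge0// sqr_ge0.
have := @expR_ge1Dxn R x^-1 k.+1 (ltW _); rewrite invr_gt0 => /(_ x0) H.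
have {H} : x^-1 ^+ k.+2 / (k.+2)`!%:R <= expR x^-1.
  by apply: le_trans H; rewrite lerDr.
rewrite /flat x0 expRN ler_pdivrMr ?ltr0n ?fact_gt0// => H.
rewrite ler_pdivrMr ?expR_gt0//.
rewrite mulrAC mulrC -ler_pdivrMl ?exprn_gt0// mulrC [leRHS]mulrC.
by apply: le_trans H; rewrite -[k.+2]addn2 exprD -exprVn.
Qed.

Lemma is_derive_flat k x :
  is_derive (x : R^o) (1 : R^o) (flat k : R^o -> R^o)
    (flat k.+2 x - k%:R * flat k.+1 x).
Proof.
have [x0|x0|->] := ltgtP x 0.
- apply: (@near_eq_is_derive _ _ _ (cst 0 : R^o -> R^o)).
    by near=> y; rewrite flat_le0//; apply/ltW; near: y; exact: lt_nbhsl.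
  by rewrite !flat_le0 ?(ltW x0)// mulr0 subr0; exact: is_derive_cst.
- apply: (@near_eq_is_derive _ _ _
    (fun y : R^o => y^-1 ^+ k * expR (- y^-1) : R^o)).
    by near=> y; rewrite /flat ifT//; near: y; exact: lt_nbhsr.
  have xn0 : x != 0 by rewrite gt_eqF.
  have dV : is_derive (x : R^o) (1 : R^o) (fun y : R^o => y^-1 : R^o) (- x ^- 2).
    have := @is_deriveV R id x 1 1 xn0 (is_derive_id _ _).
    by move/is_derive_eq; apply; rewrite /= [_ *: _]mulr1.
  have dE : is_derive (x : R^o) (1 : R^o) (fun y : R^o => expR (- y^-1) : R^o)
     (expR (- x^-1) * x ^- 2).
    have := @is_derive1_comp R expR (fun y => - y^-1) x _ _
      (is_derive_expR _) (is_deriveN dV).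
    by move/is_derive_eq; apply; rewrite opprK.
  have := is_deriveM (is_deriveX k dV) dE.
  rewrite (_ : (_ ^+ k * _) = (fun y : R^o => y^-1 ^+ k * expR (- y^-1) : R^o)); last first.
    by apply/funext => y; rewrite !fctE.
  move/is_derive_eq; apply.
  rewrite /flat x0 -!exprVn /GRing.scale/= fctE.
  case: k => [|k] /=; first by rewrite !expr0 !mul0r !mulr0 subr0 addr0; ring.
  rewrite !exprS; ring.
- rewrite !flat_le0// mulr0 subr0.
  have flat0 : flat k 0 = 0 by exact: flat_le0.
  have C : (h^-1 *: ((flat k \o shift (0 : R^o)) (h *: (1 : R^o)) - flat k 0)
     : R^o) @[h --> (0 : R^o)^'] --> (0 : R^o).
    apply/cvgrPdist_le => e e0; near=> h.
    rewrite sub0r normrN /= flat0 subr0 addr0 /GRing.scale/= mulr1.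
    have hn0 : h != 0 by near: h; exact: nbhs_dnbhs_neq.
    rewrite normrM normfV ler_pdivrMl ?normr_gt0//.
    rewrite (ger0_norm (flat_ge0 _ _)) (le_trans (flat_le_sqr _ _))//.
    rewrite -(real_normK (num_real h)) expr2 mulrA mulrC ler_wpM2l//.
    rewrite -ler_pdivlMl ?ltr0n ?fact_gt0// mulrC.
    near: h; apply: dnbhs0_le.
    by rewrite divr_gt0// ltr0n fact_gt0.
  by split; [apply/cvg_ex; exists 0 | apply/cvg_lim].
Unshelve. all: by end_near. Qed.

End flat_function.

(** * Smoothness through classes closed under differentiation *)

Section smooth_class.
Context {R : realType}.

(** Induction on the order, for all members of the class at once. Closure under scaling is there
    because the derivative in direction [v] is [v] times the ordinary one. *)
Lemma smooth_on_class (C : set (R -> R)) :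
  (forall f, C f -> exists2 g, C g &
     forall x, is_derive (x : R^o) (1 : R^o) (f : R^o -> R^o) (g x)) ->
  (forall c f, C f -> C (fun x => f x * c)) ->
  forall f, C f -> smooth_on [set: R^o] f.
Proof.
move=> Cder CZ f Cf k; elim: k f Cf => [|k IH] f Cf /=.
  move=> x _; have [g _ /(_ x) [dfx _]] := Cder _ Cf.
  by apply: differentiable_continuous; apply/derivable1_diffP.
have [g Cg df] := Cder _ Cf.
have diff x : differentiable (f : R^o -> R^o) (x : R^o).
  by apply/derivable1_diffP; have [] := df x.
split=> [x v _|v]; first exact: diff_derivable.
rewrite (_ : 'D_v _ = fun x => g x * v); first exact/IH/CZ.
apply/funext => x; rewrite deriveE// diff1E// derive1E.
by have [_ ->] := df x; rewrite /GRing.scale/= mulrC.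
Qed.

(** The last constructor adds antiderivatives: [plateau], built from integrals of bumps, enters the
    class through its derivative. *)
Inductive flat_class : (R -> R) -> Prop :=
| flat_class_flat k a b : flat_class (fun x => flat k (a * x + b))
| flat_class_cst c : flat_class (fun=> c)
| flat_class_add f g : flat_class f -> flat_class g ->
    flat_class (fun x => f x + g x)
| flat_class_mul f g : flat_class f -> flat_class g ->
    flat_class (fun x => f x * g x)
| flat_class_primitive F f : flat_class f ->
    (forall x, is_derive (x : R^o) (1 : R^o) (F : R^o -> R^o) (f x)) ->
    flat_class F.

Lemma flat_class_derive f : flat_class f -> exists2 g, flat_class g &
  forall x, is_derive (x : R^o) (1 : R^o) (f : R^o -> R^o) (g x).
Proof.
elim=> [k a b|c|{}f g Cf [f' Cf' df] Cg [g' Cg' dg]|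
    {}f g Cf [f' Cf' df] Cg [g' Cg' dg]|F g Cg _ dF].
- exists (fun x => (flat k.+2 (a * x + b) +
      (- k%:R) * flat k.+1 (a * x + b)) * a).
    apply: flat_class_mul (flat_class_cst _).
    apply: flat_class_add; first exact: flat_class_flat.
    by apply: flat_class_mul (flat_class_flat _ _ _); exact: flat_class_cst.
  move=> x.
  have da : is_derive (x : R^o) (1 : R^o) (fun y : R^o => a * y + b : R^o) a.
    have := is_deriveD (is_deriveZ a (is_derive_id (x : R^o) (1 : R^o)))
      (is_derive_cst (b : R^o) (x : R^o) (1 : R^o)).
    move=> H; have := is_derive_eq H.
    by apply; rewrite /GRing.scale/= mulr1 addr0.
  have := @is_derive1_comp R (flat k) (fun y => a * y + b) x _ _
    (is_derive_flat k _) da.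
  by move/is_derive_eq; apply; rewrite mulNr.
- by exists (fun=> 0) => [|x]; [exact: flat_class_cst | exact: is_derive_cst].
- by exists (fun x => f' x + g' x) => [|x]; [exact: flat_class_add|
    exact: is_deriveD].
- exists (fun x => f x * g' x + g x * f' x) => [|x]; last exact: is_deriveM.
  by apply: flat_class_add; exact: flat_class_mul.
- by exists g.
Qed.

Lemma flat_class_smooth f : flat_class f -> smooth_on [set: R^o] f.
Proof.
apply: (smooth_on_class (C := flat_class)) => [|c g Cg].
  exact: flat_class_derive.
by apply: flat_class_mul => //; exact: flat_class_cst.
Qed.

Lemma flat_class_continuous f : flat_class f -> continuous f.
Proof.
move=> /flat_class_derive[g _ df] x.
apply: (@differentiable_continuous _ (R^o) (R^o)).
by apply/derivable1_diffP; have [] := df x.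
Qed.

End smooth_class.

(** * Bumps, smooth steps and plateaus *)

Section bump_functions.
Context {R : realType}.
Notation mu := (@lebesgue_measure R).
Implicit Types a b x : R.

Lemma flat0_nondecreasing : {homo @flat R 0 : x y / x <= y}.
Proof.
move=> x y xy; have [x0|x0] := leP x 0; first by rewrite flat_le0// flat_ge0.
have y0 : 0 < y by exact: lt_le_trans xy.
by rewrite /flat x0 y0 !expr0 !mul1r ler_expR lerN2 lef_pV2 ?posrE.
Qed.

(* Written with explicit affine maps [c * x + e] to match [flat_class_flat]. *)
Definition flat_bump a b x : R := flat 0 (1 * x + - a) * flat 0 (-1 * x + b).

Lemma bump_ge0 a b x : 0 <= flat_bump a b x.
Proof. by rewrite mulr_ge0 ?flat_ge0. Qed.

Lemma bump_eq0 a b x : x \notin `]a, b[ -> flat_bump a b x = 0.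
Proof.
rewrite in_itv/= negb_and -!leNgt /flat_bump => /orP[xa|bx].
  by rewrite [flat _ _]flat_le0 ?mul0r// mul1r subr_le0.
by rewrite [X in _ * X]flat_le0 ?mulr0// mulN1r addrC subr_le0.
Qed.

Lemma bump_flat_class a b : flat_class (flat_bump a b).
Proof. by apply: flat_class_mul; exact: flat_class_flat. Qed.

Lemma bump_continuous a b : continuous (flat_bump a b).
Proof. exact/flat_class_continuous/bump_flat_class. Qed.

Lemma bump_patch a b (D : set R) : `]a, b[%classic `<=` D ->
  flat_bump a b \_ D = flat_bump a b.
Proof.
move=> abD; apply/funext => x; rewrite /patch; case: ifPn => // /negP xD.
rewrite bump_eq0//; apply/negP => xab; apply: xD; rewrite inE.
exact: abD.
Qed.

Lemma bump_integrable a b (D : set R) : measurable D ->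
  mu.-integrable D (EFin \o flat_bump a b).
Proof.
move=> mD; apply: (@integrableS _ _ _ mu setT) => //.
have -> : EFin \o flat_bump a b = (EFin \o flat_bump a b) \_ `[a, b].
  by rewrite restrict_EFin bump_patch//; exact: subset_itv_oo_cc.
apply/(integrable_mkcond _ _).1 => //.
apply: continuous_compact_integrable; first exact: segment_compact.
by apply: continuous_subspaceT => x; exact: bump_continuous.
Qed.

Definition bump_mass a b : R := \int[mu]_x flat_bump a b x.

Lemma bump_integral a b (D : set R) : `]a, b[%classic `<=` D ->
  \int[mu]_(x in D) flat_bump a b x = bump_mass a b.
Proof. by move=> abD; rewrite Rintegral_mkcond bump_patch. Qed.

Lemma bump_mass_gt0 a b : a < b -> 0 < bump_mass a b.
Proof.
(* On the middle half of the interval both factors of the bump are at least [flat 0 r]. *)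
move=> ab; pose r := (b - a) / 4; have r0 : 0 < r by rewrite /r; lra.
pose D := `[a + r, b - r]%classic : set R; pose c := flat 0 r * flat 0 r.
have mD : measurable D by exact: measurable_itv.
have c0 : 0 < c by rewrite mulr_gt0// flat_gt0.
have muD : mu D = (b - a - 2 * r)%:E.
  rewrite lebesgue_measure_itv/= lte_fin ifT; last by rewrite /r; lra.
  by rewrite -EFinB; congr EFin; ring.
have H : c * fine (mu D) <= \int[mu]_(x in D) flat_bump a b x.
  have <- : \int[mu]_(x in D) c = c * fine (mu D) by rewrite Rintegral_cst.
  apply: (@le_Rintegral _ _ _ mu D (fun=> c) (flat_bump a b)) => //.
  - apply: (@continuous_compact_integrable _ (fun=> c)).
      exact: segment_compact.
    by apply: continuous_subspaceT => x; exact: cvg_cst.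
  - exact: bump_integrable.
  - move=> x; rewrite /D/= in_itv/= => /andP[x1 x2].
    by rewrite ler_pM ?flat_ge0// flat0_nondecreasing//; lra.
have : \int[mu]_(x in D) flat_bump a b x <= bump_mass a b.
  rewrite /bump_mass /Rintegral fine_le//.
  - by apply: integrable_fin_num => //; exact: bump_integrable.
  - by apply: integrable_fin_num => //; exact: bump_integrable.
  - apply: ge0_subset_integral => //.
      by apply/measurable_EFinP; apply: continuous_measurable_fun; exact: bump_continuous.
    by move=> x _; rewrite lee_fin bump_ge0.
apply: lt_le_trans; apply: lt_le_trans H.
by rewrite mulr_gt0// muD /= /r; lra.
Qed.

Definition nbump a b x : R := (bump_mass a b)^-1 * flat_bump a b x.

(** A smooth step: 0 up to [a], 1 from [b] on, with derivative [nbump a b]. *)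
Definition bump_step a b x : R := \int[mu]_(t in `]-oo, x]) nbump a b t.

Lemma nbump_ge0 a b x : 0 <= nbump a b x.
Proof.
rewrite mulr_ge0 ?bump_ge0// invr_ge0.
by apply: Rintegral_ge0 => ? _; exact: bump_ge0.
Qed.

Lemma nbump_eq0 a b x : x \notin `]a, b[ -> nbump a b x = 0.
Proof. by move=> xab; rewrite /nbump bump_eq0// mulr0. Qed.

Lemma nbump_flat_class a b : flat_class (nbump a b).
Proof.
exact: flat_class_mul (flat_class_cst _) (bump_flat_class a b).
Qed.

Lemma nbump_integrable a b (D : set R) : measurable D ->
  mu.-integrable D (EFin \o nbump a b).
Proof.
move=> mD; rewrite (_ : EFin \o _ = fun x => ((bump_mass a b)^-1%:E * (flat_bump a b x)%:E)%E)//.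
by apply: integrableZl => //; exact: bump_integrable.
Qed.

Lemma nbump_integral a b (D : set R) : a < b -> measurable D ->
  `]a, b[%classic `<=` D -> \int[mu]_(x in D) nbump a b x = 1.
Proof.
move=> ab mD abD; rewrite RintegralZl//; last exact: bump_integrable.
by rewrite bump_integral// mulVf// gt_eqF// bump_mass_gt0.
Qed.

Lemma is_derive_bump_step a b x :
  is_derive (x : R^o) (1 : R^o) (bump_step a b : R^o -> R^o) (nbump a b x).
Proof.
have xx1 : x < x + 1 by rewrite ltrDl.
have [d1 d2] : derivable (bump_step a b) x 1 /\
    derive1 (bump_step a b) x = nbump a b x.
  apply: (continuous_FTC1 xx1); first exact: nbump_integrable.
    by rewrite ltNyr.
  exact/flat_class_continuous/nbump_flat_class.
by apply: DeriveDef; [exact: d1 | rewrite -derive1E].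
Qed.

Lemma bump_step_le a b x : x <= a -> bump_step a b x = 0.
Proof.
move=> xa; rewrite /bump_step (@eq_Rintegral _ _ _ _ _ (fun=> 0)).
  by rewrite Rintegral_cst// mul0r.
move=> t; rewrite inE/= in_itv/= => tx; rewrite nbump_eq0// in_itv/=.
by rewrite negb_and -leNgt (le_trans tx).
Qed.

Lemma bump_step_ge a b x : a < b -> b <= x -> bump_step a b x = 1.
Proof.
move=> ab bx; rewrite /bump_step nbump_integral// => t /=.
by rewrite !in_itv/= => /andP[_ tb]; rewrite (le_trans (ltW tb)).
Qed.

Lemma bump_step_ge0 a b x : 0 <= bump_step a b x.
Proof. by apply: Rintegral_ge0 => ? _; exact: nbump_ge0. Qed.

Lemma bump_step_le1 a b x : a < b -> bump_step a b x <= 1.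
Proof.
move=> ab; rewrite -(nbump_integral ab measurableT)//.
rewrite /bump_step /Rintegral fine_le//.
- by apply: integrable_fin_num => //; exact: nbump_integrable.
- by apply: integrable_fin_num => //; exact: nbump_integrable.
- apply: ge0_subset_integral => //.
    apply/measurable_EFinP; apply: continuous_measurable_fun.
    exact/flat_class_continuous/nbump_flat_class.
  by move=> t _; rewrite lee_fin nbump_ge0.
Qed.

(** It rises from 0 to 1 on [[e, 2e]] and falls back on [[1 - 2e, 1 - e]], so its derivative is a
    unit bump near 0 minus a unit bump near 1. *)
Definition plateau (e x : R) : R :=
  bump_step e (2 * e) x - bump_step (1 - 2 * e) (1 - e) x.

Lemma is_derive_plateau e x :
  is_derive (x : R^o) (1 : R^o) (plateau e : R^o -> R^o)
    (nbump e (2 * e) x - nbump (1 - 2 * e) (1 - e) x).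
Proof. by apply: is_deriveB; exact: is_derive_bump_step. Qed.

Lemma derive1_plateau e x :
  derive1 (plateau e) x = nbump e (2 * e) x - nbump (1 - 2 * e) (1 - e) x.
Proof. by rewrite derive1E; have [_ ->] := is_derive_plateau e x. Qed.

Lemma plateau_norm_le1 e x : 0 < e -> `|plateau e x| <= 1.
Proof.
move=> e0.
have := bump_step_ge0 e (2 * e) x.
have := bump_step_ge0 (1 - 2 * e) (1 - e) x.
have : bump_step e (2 * e) x <= 1 by apply: bump_step_le1; lra.
have : bump_step (1 - 2 * e) (1 - e) x <= 1 by apply: bump_step_le1; lra.
rewrite ler_norml /plateau.
by move: (bump_step _ _ _) (bump_step _ _ _) => s t *; apply/andP; split; lra.
Qed.

Lemma plateau_test_function e : 0 < e -> e <= 8^-1 ->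
  test_function01 (plateau e).
Proof.
move=> e0 e8.
(* Compactness and the inclusion in the open interval both follow from this closed interval. As
   [e <= 1/8], the two ramps do not overlap. *)
have Cl : closure [set t | plateau e t != 0] `<=` `[e, 1 - e].
  have /closure_id -> : closed (`[e, 1 - e]%classic : set R) by exact: interval_closed.
  apply: closure_subset => t /=; apply: contra_neqP => /negP.
  rewrite in_itv/= negb_and -!ltNge /plateau => /orP[te|te].
    by rewrite !bump_step_le ?subrr//; lra.
  by rewrite !bump_step_ge ?subrr//; lra.
split.
- apply: flat_class_smooth.
  apply: (flat_class_primitive _ (is_derive_plateau e)).
  apply: flat_class_add; first exact: nbump_flat_class.
  have -> : (fun x => - nbump (1 - 2 * e) (1 - e) x) =
    (fun x => -1 * nbump (1 - 2 * e) (1 - e) x).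
    by apply/funext => x; rewrite mulN1r.
  by apply: flat_class_mul (nbump_flat_class _ _); exact: flat_class_cst.
- by apply: subclosed_compact Cl; [exact: closed_closure | exact: segment_compact].
- by move=> t /Cl /=; rewrite !in_itv/= => /andP[? ?]; apply/andP; split; lra.
Qed.

End bump_functions.

(** * Weak derivatives *)

Section weak_derivative.
Context {R : realType}.
Notation mu := (@lebesgue_measure R).
Implicit Types (u G : R -> R).

Lemma within_continuous_integrable u (a b : R) (D : set R) :
  {within `[a, b], continuous u} -> measurable D -> D `<=` `[a, b]%classic ->
  mu.-integrable D (EFin \o u).
Proof.
move=> cu mD Dab; apply: (@integrableS _ _ _ mu `[a, b]) => //.
by apply: continuous_compact_integrable => //; exact: segment_compact.
Qed.

Lemma within_nbump_integrable u a b :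
  {within `[0, 1], continuous u} ->
  mu.-integrable `]0, 1[ (EFin \o (fun t => u t * nbump a b t)).
Proof.
move=> cu; apply: (@within_continuous_integrable _ 0 1) => //; last first.
  exact: subset_itv_oo_cc.
move=> x; apply: continuousM; first exact: cu.
apply: continuous_subspaceT; exact/flat_class_continuous/nbump_flat_class.
Qed.

(** The normalised bump is a probability density vanishing off []a, b[], so it averages values of
    [u] that all lie within [e] of [c]. *)
Lemma nbump_average u (a b c e : R) : {within `[0, 1], continuous u} ->
  0 <= a -> a < b -> b <= 1 -> (forall t, t \in `]a, b[ -> `|u t - c| <= e) ->
  `|\int[mu]_(t in `]0, 1[) (u t * nbump a b t) - c| <= e.
Proof.
move=> cu a0 ab b1 uc.
have ab01 : `]a, b[%classic `<=` (`]0, 1[%classic : set R).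
  by move=> t /=; rewrite !in_itv/= => /andP[? ?]; apply/andP; split; lra.
have m01 : measurable (`]0, 1[%classic : set R) by exact: measurable_itv.
have nI k : mu.-integrable `]0, 1[ (EFin \o (fun t => k * nbump a b t)).
  by apply: within_nbump_integrable => x; exact: cvg_cst.
have n1 k : \int[mu]_(t in `]0, 1[) (k * nbump a b t) = k.
  rewrite RintegralZl//; last exact: nbump_integrable.
  by rewrite nbump_integral// mulr1.
rewrite -{1}(n1 c) -RintegralB//; last exact: within_nbump_integrable.
have bnd t : `|u t * nbump a b t - c * nbump a b t| <= e * nbump a b t.
  rewrite -mulrBl normrM (ger0_norm (nbump_ge0 _ _ _)).
  have [tab|tab] := boolP (t \in `]a, b[).
    by rewrite ler_wpM2r ?nbump_ge0 ?uc.
  by rewrite nbump_eq0// !mulr0.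
have dI : mu.-integrable `]0, 1[
    (EFin \o (fun t => u t * nbump a b t - c * nbump a b t)).
  rewrite (_ : EFin \o _ = (fun t => (u t * nbump a b t)%:E -
    (c * nbump a b t)%:E)%E)//.
  by apply: integrableB => //; [exact: within_nbump_integrable | exact: nI].
apply: le_trans; first by apply: le_normr_Rintegral.
rewrite -[leRHS](n1 e); apply: le_Rintegral => //.
exact: (integrable_norm dI).
Qed.

(** Tested against a plateau, the left-hand side is an average of [u] near 1 minus one near 0, while
    the right-hand side is at most the integral of [|G|] because the plateau takes values in
    [[-1, 1]]. *)
Lemma weak_derivative_bound u G : {within `[0, 1], continuous u} ->
  mu.-integrable `]0, 1[ (EFin \o G) ->
  (forall phi : R -> R, test_function01 phi ->
    - (\int[mu]_(t in `]0, 1[) (u t * derive1 phi t)) =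
    \int[mu]_(t in `]0, 1[) (G t * phi t)) ->
  `|u 1 - u 0| <= \int[mu]_(t in `]0, 1[) `|G t|.
Proof.
move=> cu iG weak; apply/ler_addgt0Pr => e e0.
have m01 : measurable (`]0, 1[%classic : set R) by exact: measurable_itv.
have nbh (x : R) : x \in `[0, 1] -> exists2 r, 0 < r &
    forall t, t \in `[0, 1] -> `|x - t| < r -> `|u t - u x| <= e / 2.
  move=> x01; have /subspace_continuousP/(_ x x01) := cu.
  have e2 : 0 < e / 2 by rewrite divr_gt0.
  move=> /cvgrPdist_le/(_ _ e2); rewrite near_withinE.
  move=> /nbhs_ballP[r /= r0 H]; exists r => // t t01 xt.
  by rewrite distrC; exact: H.
have [|r0 r0_gt0 H0] := nbh 0; first by rewrite in_itv/= lexx ler01.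
have [|r1 r1_gt0 H1] := nbh 1; first by rewrite in_itv/= lexx ler01.
(* The bumps live in []r, 2r[] and []1 - 2r, 1 - r[]; halving [r0] and [r1] puts them where [u] is
   within [e / 2] of its end values, and [1/8] makes the plateau a test function. *)
pose r := Num.min 8^-1 (Num.min (r0 / 2) (r1 / 2)).
have r_gt0 : 0 < r by rewrite !lt_min invr_gt0 ltr0n !divr_gt0.
have r8 : r <= 8^-1 by rewrite ge_min lexx.
have rr0 : r <= r0 / 2 by rewrite !ge_min lexx/= orbT.
have rr1 : r <= r1 / 2 by rewrite !ge_min lexx !orbT.
have A0 : `|\int[mu]_(t in `]0, 1[) (u t * nbump r (2 * r) t) - u 0| <= e / 2.
  apply: nbump_average => //; [lra..|move=> t].
  rewrite in_itv/= => /andP[t1 t2]; apply: H0.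
    by rewrite in_itv/=; apply/andP; split; lra.
  by rewrite sub0r normrN ger0_norm; lra.
have A1 : `|\int[mu]_(t in `]0, 1[)
    (u t * nbump (1 - 2 * r) (1 - r) t) - u 1| <= e / 2.
  apply: nbump_average => //; [lra..|move=> t].
  rewrite in_itv/= => /andP[t1 t2]; apply: H1.
    by rewrite in_itv/=; apply/andP; split; lra.
  by rewrite ger0_norm; lra.
have := weak _ (plateau_test_function r_gt0 r8).
have -> : \int[mu]_(t in `]0, 1[) (u t * derive1 (plateau r) t) =
    \int[mu]_(t in `]0, 1[) (u t * nbump r (2 * r) t -
      u t * nbump (1 - 2 * r) (1 - r) t).
  by apply: eq_Rintegral => t _; rewrite derive1_plateau mulrBr.
rewrite RintegralB//; [|exact: within_nbump_integrable..].
move=> weakE.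
have GI : mu.-integrable `]0, 1[ (EFin \o (fun t => G t * plateau r t)).
  move: (iG) => /le_integrable; apply => //.
    apply/measurable_EFinP; apply: measurable_funM.
      by apply/measurable_EFinP; case/integrableP : iG.
    apply: measurable_funTS; apply: continuous_measurable_fun => x.
    apply: (@differentiable_continuous _ (R^o) (R^o)).
    by apply/derivable1_diffP; have [] := is_derive_plateau r x.
  by move=> t _ /=; rewrite lee_fin normrM ler_piMr ?plateau_norm_le1.
have GB : `|\int[mu]_(t in `]0, 1[) (G t * plateau r t)| <=
    \int[mu]_(t in `]0, 1[) `|G t|.
  apply: le_trans; first by apply: le_normr_Rintegral.
  apply: le_Rintegral => //; [exact: integrable_norm GI|exact: integrable_norm iG|].
  by move=> t _; rewrite normrM ler_piMr ?plateau_norm_le1.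
move: A0 A1 GB; rewrite -weakE !ler_norml.
move: (\int[mu]_(t in _) (u t * nbump r _ t)) => I0.
move: (\int[mu]_(t in _) (u t * _)) => I1.
move: (\int[mu]_(t in _) `|_|) (u 0) (u 1) => I2 u0 u1.
move=> {}A0 {}A1 {}GB {H0 H1 G iG weak GI weakE nbh}.
by move: A0 A1 GB => /andP[? ?] /andP[? ?] /andP[? ?]; apply/andP; split; lra.
Qed.

End weak_derivative.

(** * The graph metric dominates the Euclidean distance *)

Section theta_facts.
Context {R : realType} (theta : R -> R -> R).
Hypothesis Htheta : interpolation_function theta.
Implicit Types s t m : R.

Lemma theta_mono s t s' t' : 0 <= s -> 0 <= t -> s <= s' -> t <= t' ->
  theta s t <= theta s' t'.
Proof.
move=> s0 t0 ss tt; have s'0 := le_trans s0 ss; have t'0 := le_trans t0 tt.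
apply: (@le_trans _ _ (theta s' t)); first exact: (theta_nondecreasing Htheta).
by rewrite !(@theta_sym _ _ Htheta s')//; exact: (theta_nondecreasing Htheta).
Qed.

Lemma theta_le1 s t : 0 <= s -> s <= 1 -> 0 <= t -> t <= 1 -> theta s t <= 1.
Proof. by move=> *; rewrite -[leRHS](theta11 Htheta); exact: theta_mono. Qed.

(** Homogeneity and normalisation give [theta m m = m]; monotonicity does the rest. *)
Lemma theta_ge m s t : 0 < m -> m <= s -> m <= t -> m <= theta s t.
Proof.
move=> m0 ms mt; apply: (@le_trans _ _ (theta (m * 1) (m * 1))).
  by rewrite (theta_homogeneous Htheta)// (theta11 Htheta) mulr1.
by rewrite mulr1; apply: theta_mono => //; exact: ltW.
Qed.

Lemma theta_within_continuous (D : set R) (a b : R -> R) :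
  {within D, continuous a} -> {within D, continuous b} ->
  (forall t, D t -> 0 <= a t) -> (forall t, D t -> 0 <= b t) ->
  {within D, continuous (fun t => theta (a t) (b t))}.
Proof.
move=> /subspace_continuousP ca /subspace_continuousP cb a0 b0.
apply/subspace_continuousP => t Dt.
pose A := [set x : R^o * R^o | 0 <= x.1 /\ 0 <= x.2].
have /subspace_continuousP/(_ (a t, b t)) := theta_continuous Htheta.
move=> /(_ (conj (a0 _ Dt) (b0 _ Dt))) cth.
apply: (@cvg_comp _ _ _ (fun s => (a s, b s) : R^o * R^o)
  (fun x => theta x.1 x.2) _ (within A (nbhs (a t, b t)))) => //.
move=> U /= AU.
have cab : (a s, b s) @[s --> within D (nbhs t)] --> (a t, b t).
  exact: (cvg_pair (ca _ Dt) (cb _ Dt)).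
have {}AU : nbhs t [set s | D s -> A (a s, b s) -> U (a s, b s)] := cab _ AU.
change (nbhs t [set s | D s -> U (a s, b s)]).
apply: filterS AU => s H Ds; apply: H => //.
by split; [exact: (a0 _ Ds) | exact: (b0 _ Ds)].
Qed.

End theta_facts.

(** * Lower bound on the action of a competitor *)

Section graph_action_lower_bound.
Context {R : realType} {n : nat} (theta : R -> R -> R) (q : 'M[R]_n.+1).
Hypotheses (Htheta : interpolation_function theta) (hq : weighted_graph q)
  (hsym : symmetric_graph q).
Variables (p : R -> 'rV[R]_n.+1) (v : R -> 'M[R]_n.+1).
Notation mu := (@lebesgue_measure R).

Definition action_density (t : R) : R :=
  2^-1 * \sum_i \sum_j v t i j ^+ 2 * theta (p t 0 i) (p t 0 j) * q i j.

Definition graph_divergence (i : 'I_n.+1) (t : R) : R :=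
  2^-1 * (\sum_j theta (p t 0 i) (p t 0 j) * (v t i j - v t j i) * q i j).

Hypothesis Hp : graph_continuity_equation theta q p v.

Let p01 t i : t \in `[0, 1] -> 0 <= p t 0 i <= 1.
Proof.
case: Hp => + _ _ _ _ => /(_ t) + t01 => /(_ t01) [p0 p1].
rewrite p0/= -p1 (bigD1 i)//= lerDl sumr_ge0//.
Qed.

Lemma coord_within_continuous i : {within `[0, 1], continuous (fun t => p t 0 i)}.
Proof.
case: Hp => _ cp _ _ _.
apply: (@within_continuous_comp _ _ _ _ p (fun M : 'rV[R]_n.+1 => M 0 i)) => //.
by move=> x _; exact: coord_continuous.
Qed.

Lemma theta_coord_within_continuous i j :
  {within `[0, 1], continuous (fun t => theta (p t 0 i) (p t 0 j))}.
Proof.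
apply: (theta_within_continuous Htheta); [exact: coord_within_continuous..| |] => t t01.
  by have /andP[] := p01 i t01.
by have /andP[] := p01 j t01.
Qed.

Lemma theta_coord_measurable i j :
  measurable_fun (`[0, 1] : set R) (fun t => theta (p t 0 i) (p t 0 j)).
Proof.
apply: (@subspace_continuous_measurable_fun R `[0, 1]) => //.
exact: theta_coord_within_continuous.
Qed.

Lemma action_density_measurable :
  measurable_fun (`[0, 1] : set R) action_density.
Proof.
case: Hp => _ _ mv _ _.
apply: measurable_funM; first exact: measurable_cst.
apply: measurable_sum => i; apply: measurable_sum => j.
apply: measurable_funM; last exact: measurable_cst.
apply: measurable_funM; last exact: theta_coord_measurable.
exact: measurable_funX.
Qed.

Lemma graph_divergence_measurable i :
  measurable_fun (`[0, 1] : set R) (graph_divergence i).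
Proof.
case: Hp => _ _ mv _ _.
apply: measurable_funM; first exact: measurable_cst.
apply: measurable_sum => j.
apply: measurable_funM; last exact: measurable_cst.
apply: measurable_funM; first exact: theta_coord_measurable.
exact: measurable_funB.
Qed.

Let term_ge0 t i j : t \in `[0, 1] ->
  0 <= v t i j ^+ 2 * theta (p t 0 i) (p t 0 j) * q i j.
Proof.
move=> t01; have /andP[i0 _] := p01 i t01; have /andP[j0 _] := p01 j t01.
by rewrite mulr_ge0// mulr_ge0 ?sqr_ge0//; exact: (theta_ge0 Htheta).
Qed.

Lemma action_density_ge0 t : t \in `[0, 1] -> 0 <= action_density t.
Proof.
move=> t01; rewrite mulr_ge0// sumr_ge0// => i _; rewrite sumr_ge0// => j _.
exact: term_ge0.
Qed.

(* Young's inequality [2 |x| <= a x^2 + a^-1], summed against theta <= 1. *)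
Lemma graph_divergence_young a t i : 0 < a -> t \in `[0, 1] ->
  `|graph_divergence i t| <=
  a * action_density t + (\sum_i \sum_j q i j) / a.
Proof.
move=> a0 t01.
pose T k l := v t k l ^+ 2 * theta (p t 0 k) (p t 0 l) * q k l.
have young k l : theta (p t 0 k) (p t 0 l) * `|v t k l| * q k l <=
    2^-1 * (a * T k l + q k l / a).
  have /andP[k0 k1] := p01 k t01; have /andP[l0 l1] := p01 l t01.
  have h0 := theta_ge0 Htheta k0 l0; have h1 := theta_le1 Htheta k0 k1 l0 l1.
  have y : `|v t k l| <= 2^-1 * (a * v t k l ^+ 2 + a^-1).
    have : 0 <= (a * `|v t k l| - 1) ^+ 2 by exact: sqr_ge0.
    rewrite sqrrB exprMn real_normK ?num_real// mulr1 expr1n => H.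
    rewrite -(ler_pM2l a0) mulrCA mulrDr mulfV ?gt_eqF//; lra.
  have qa : 0 <= q k l / a by rewrite divr_ge0 ?hq// ltW.
  apply: (@le_trans _ _
    (2^-1 * (a * T k l + theta (p t 0 k) (p t 0 l) * (q k l / a)))).
    have := ler_wpM2r (hq k l) (ler_wpM2l h0 y); rewrite /T; nra.
  by rewrite ler_wpM2l// lerD2l ler_piMl.
(* A row of a nonnegative matrix is bounded by the total. It is used for row [i] and, after
   transposition, for column [i] of [T]. *)
have Tsum k (P : 'I_n.+1 -> 'I_n.+1 -> R) : (forall i j, 0 <= P i j) ->
    \sum_j P k j <= \sum_i \sum_j P i j.
  move=> P0; rewrite [leRHS](bigD1 k)//= lerDl sumr_ge0// => i' _.
  by rewrite sumr_ge0.
have T0 k l : 0 <= T k l by exact: term_ge0.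
have le1 : \sum_j T i j <= 2 * action_density t.
  by rewrite /action_density mulrA mulfV// mul1r; exact: (Tsum i T T0).
have le2 : \sum_j T j i <= 2 * action_density t.
  rewrite /action_density mulrA mulfV// mul1r exchange_big/=.
  exact: (Tsum i (fun k l => T l k)).
have le3 : \sum_j q i j / a <= (\sum_i \sum_j q i j) / a.
  by rewrite -mulr_suml ler_wpM2r ?invr_ge0 ?(ltW a0)//; exact: (Tsum i q hq).
have le4 : 0 <= (\sum_i \sum_j q i j) / a.
  by rewrite divr_ge0 ?(ltW a0)// sumr_ge0// => k _; rewrite sumr_ge0.
rewrite /graph_divergence normrM ger0_norm//.
have : `|\sum_j theta (p t 0 i) (p t 0 j) * (v t i j - v t j i) * q i j| <=
    \sum_j (2^-1 * (a * T i j + q i j / a) + 2^-1 * (a * T j i + q i j / a)).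
  apply: (le_trans (ler_norm_sum _ _ _)); apply: ler_sum => j _.
  have /andP[i0 _] := p01 i t01; have /andP[j0 _] := p01 j t01.
  have Y1 := young i j; have Y2 := young j i.
  rewrite (theta_sym Htheta j0 i0) (hsym j i) in Y2.
  apply: le_trans (lerD Y1 Y2); rewrite -mulrDl -mulrDr !normrM.
  rewrite (ger0_norm (theta_ge0 Htheta i0 j0)) (ger0_norm (hq i j)).
  by rewrite ler_wpM2r// ler_wpM2l ?(theta_ge0 Htheta)// ler_normB.
rewrite big_split/= -!mulr_sumr !big_split/= -!mulr_sumr => H.
have := ler_wpM2l (ltW a0) le1; have := ler_wpM2l (ltW a0) le2.
move: H le3 le4.
move: (\sum_j T i j) (\sum_j T j i) (\sum_j q i j / a) ((\sum_i _) / a).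
move: (action_density t) `|_| => A N x1 x2 x3 x4.
have -> : a * A = (a * (2 * A)) / 2 by field.
move: (a * x1) (a * x2) (a * (2 * A)) => *.
lra.
Qed.

(** The constant [Q] exceeds the total weight by 1, which keeps it positive even when all weights
    vanish. An infinite action makes the claim trivial; otherwise Young's bound is integrated for
    each [a] and [a] is then optimised. *)
Lemma graph_action_ge i :
  ((`|p 1 0 i - p 0 0 i| ^+ 2 / (4 * (1 + \sum_i \sum_j q i j)))%:E <=
    graph_action theta q p v)%E.
Proof.
pose Q := 1 + \sum_i \sum_j q i j; rewrite -/Q.
have Q0 : 0 < Q.
  rewrite ltr_pwDl// sumr_ge0// => k _; rewrite sumr_ge0// => l _; exact: hq.
have A0 : (0 <= graph_action theta q p v)%E.
  by apply: integral_ge0 => t t01; rewrite lee_fin; exact: action_density_ge0.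
have [Ainf|Afin] := eqVneq (graph_action theta q p v) +oo%E.
  by rewrite Ainf leey.
have m01 : measurable (`]0, 1[%classic : set R) by exact: measurable_itv.
have moo (f : R -> R) : measurable_fun (`[0, 1] : set R) f ->
    measurable_fun (`]0, 1[ : set R) f.
  by apply: measurable_funS => //; exact: subset_itv_oo_cc.
have mAD : measurable_fun (`]0, 1[ : set R) (EFin \o action_density).
  by apply/measurable_EFinP; apply: moo; exact: action_density_measurable.
have Aoo : graph_action theta q p v =
    (\int[mu]_(t in `]0%R, 1%R[) (action_density t)%:E)%E.
  exact: (integral_itv_bndoo true false mAD).
have sub t : `]0, 1[%classic t -> t \in `[0, 1].
  by move=> /=; exact: subset_itv_oo_cc.
have AI : mu.-integrable `]0, 1[ (EFin \o action_density).
  apply/integrableP; split=> //.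
  under eq_integral => t.
    rewrite inE => t01; rewrite gee0_abs; last first.
      by rewrite lee_fin; exact/action_density_ge0/sub.
    over.
  by rewrite -Aoo ltey.
have [A AE] : exists A, graph_action theta q p v = A%:E.
  exists (fine (graph_action theta q p v)); rewrite fineK//.
  by rewrite ge0_fin_numE// ltey.
have RA : \int[mu]_(t in `]0, 1[) action_density t = A.
  by rewrite /Rintegral -Aoo AE.
have cI c : mu.-integrable `]0, 1[ (EFin \o (fun=> c)).
  apply: (@within_continuous_integrable _ _ 0 1) => //.
    by apply: continuous_subspaceT => x; exact: cvg_cst.
  exact: subset_itv_oo_cc.
have aI a : mu.-integrable `]0, 1[ (EFin \o (fun t => a * action_density t)).
  by apply: (@integrableZl _ _ _ mu _ m01 a _ AI).
have bI a : 0 < a -> mu.-integrable `]0, 1[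
    (EFin \o (fun t => a * action_density t + (\sum_i \sum_j q i j) / a)).
  move=> a0; rewrite (_ : EFin \o _ = (fun t => a%:E * (action_density t)%:E +
    ((\sum_i \sum_j q i j) / a)%:E)%E)//.
  apply: integrableD => //; [exact: aI | exact: cI].
have GI : mu.-integrable `]0, 1[ (EFin \o graph_divergence i).
  move: (bI 1 ltr01) => /le_integrable; apply => //.
    by apply/measurable_EFinP; apply: moo; exact: graph_divergence_measurable.
  move=> t /sub t01 /=; rewrite lee_fin.
  apply: (le_trans (graph_divergence_young i ltr01 t01)); exact: ler_norm.
have key a : 0 < a -> `|p 1 0 i - p 0 0 i| <= a * A + Q / a.
  move=> a0; apply: (@le_trans _ _ (\int[mu]_(t in `]0, 1[) `|graph_divergence i t|)).
    have := weak_derivative_bound (@coord_within_continuous i) GI.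
    by apply; case: Hp => _ _ _ _; exact.
  apply: (@le_trans _ _ (\int[mu]_(t in `]0, 1[)
      (a * action_density t + (\sum_i \sum_j q i j) / a))).
    apply: le_Rintegral => //; [exact: integrable_norm GI | exact: bI |].
    by move=> t /sub; exact: graph_divergence_young.
  rewrite RintegralD//.
  have -> : \int[mu]_(t in `]0, 1[) (a * action_density t) = a * A.
    by rewrite RintegralZl// RA.
  rewrite Rintegral_cst//.
  have -> : fine (mu `]0, 1[%classic) = 1.
    by rewrite lebesgue_measure_itv/= lte_fin ltr01/= subr0.
  by rewrite mulr1 lerD2l ler_wpM2r ?invr_ge0 ?(ltW a0)// /Q lerDr.
rewrite AE lee_fin; set D := `|_|.
have [->|D0] := eqVneq D 0; first by rewrite expr0n/= mul0r -lee_fin -AE.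
have {}D0 : 0 < D by rewrite lt_neqAle eq_sym D0/= normr_ge0.
(* With this [a] the bound becomes [D^2 <= 2 Q A + D^2 / 2], that is [D^2 <= 4 Q A]. *)
have := key (2 * Q / D); rewrite -/D divr_gt0 ?mulr_gt0// => /(_ isT) H.
rewrite ler_pdivrMr ?mulr_gt0//.
have := ler_wpM2r (ltW D0) H.
have -> : (2 * Q / D * A + Q / (2 * Q / D)) * D = 2 * Q * A + D ^+ 2 / 2.
  by field; rewrite !gt_eqF.
by rewrite -expr2; nra.
Qed.

End graph_action_lower_bound.

Lemma W_graph_sqr_ge (R : realType) (n : nat) (theta : R -> R -> R)
    (q : 'M[R]_n.+1) (p0 p1 : 'rV[R]_n.+1) i :
  interpolation_function theta -> weighted_graph q -> symmetric_graph q ->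
  ((`|p1 0 i - p0 0 i| ^+ 2 / (4 * (1 + \sum_i \sum_j q i j)))%:E <=
    W_graph theta q p0 p1 ^+ 2)%E.
Proof.
move=> Htheta hq hsym.
rewrite /W_graph; set I := ereal_inf _.
have H : ((`|p1 0 i - p0 0 i| ^+ 2 / (4 * (1 + \sum_i \sum_j q i j)))%:E <= I)%E.
  apply: le_ereal_inf_tmp => _ [p [v [Hp <- <- ->]]].
  exact: graph_action_ge.
(* Squaring undoes [sqrte] because the infimum is nonnegative, being above the bound just found. *)
rewrite sqr_sqrte//; apply: le_trans H.
rewrite lee_fin divr_ge0// mulr_ge0// addr_ge0// sumr_ge0// => k _.
by rewrite sumr_ge0.
Qed.

(** * Time reversal *)

(* Valid without integrability: [fine] sends both infinities to [0]. *)
Lemma RintegralN d (T : measurableType d) (R : realType)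
    (mu : {measure set T -> \bar R}) (D : set T) (f : T -> R) :
  \int[mu]_(x in D) (- f x) = - \int[mu]_(x in D) f x.
Proof.
rewrite /Rintegral [in LHS]integralE [in RHS]integralE.
have -> : (fun x => (- f x)%:E) = (\- (EFin \o f))%E by [].
rewrite funeposN funenegN.
have : (0 <= \int[mu]_(x in D) ((EFin \o f)^\+ x))%E.
  by apply: integral_ge0 => x _; exact: funepos_ge0.
have : (0 <= \int[mu]_(x in D) ((EFin \o f)^\- x))%E.
  by apply: integral_ge0 => x _; exact: funeneg_ge0.
move: (\int[mu]_(x in D) _)%E (\int[mu]_(x in D) _)%E => [x| |] [y| |] //= _ _;
  by rewrite ?oppr0// opprB.
Qed.

Section time_reversal.
Context {R : realType}.
Notation mu := (@lebesgue_measure R).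
Implicit Types (t : R) (f : R -> R).

Definition rev01 t : R := 1 - t.

Lemma rev01K : involutive rev01.
Proof. by move=> t; rewrite /rev01; ring. Qed.

Lemma rev01_continuous : continuous rev01.
Proof. by move=> t; apply: cvgB; [exact: cvg_cst | exact: cvg_id]. Qed.

Lemma measurable_rev01 : measurable_fun [set: measurableTypeR R] (rev01 : _ -> measurableTypeR R).
Proof. exact: continuous_measurable_fun rev01_continuous. Qed.

Lemma rev01_itv (b0 b1 : bool) t :
  (rev01 t \in Interval (BSide b0 0) (BSide b1 1)) =
  (t \in Interval (BSide (~~ b1) 0) (BSide (~~ b0) 1)).
Proof.
rewrite !in_itv/= /rev01 andbC.
by congr andb; [case: b1 | case: b0] => /=; apply/idP/idP; lra.
Qed.

Lemma rev01_oo : rev01 @^-1` `]0, 1[ = `]0, 1[%classic.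
Proof. by apply/seteqP; split => t /=; rewrite rev01_itv. Qed.

Lemma rev01_cc : rev01 @^-1` `[0, 1] = `[0, 1]%classic.
Proof. by apply/seteqP; split => t /=; rewrite rev01_itv. Qed.

(** By uniqueness of Lebesgue measure it suffices to compare lengths of half-open intervals;
    reversal turns []a, b]] into [[1 - b, 1 - a[]. *)
Lemma lebesgue_measure_rev01 (A : set R) : measurable A ->
  mu (rev01 @^-1` A) = mu A.
Proof.
pose f : {mfun measurableTypeR R >-> measurableTypeR R} :=
  HB.pack (rev01 : measurableTypeR R -> measurableTypeR R)
    (isMeasurableFun.Build _ _ _ _ _ measurable_rev01).
move=> mA; apply/esym.
apply: (@lebesgue_measure_unique R (pushforward mu f)) => // _ [[a b]] _ <-.
have fE : f @^-1` `]a, b] = `[1 - b, 1 - a[%classic.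
  by apply/seteqP; split => t /=; rewrite !in_itv/= /rev01 => /andP[? ?];
    apply/andP; split; lra.
transitivity (mu `[1 - b, 1 - a[%classic); last by rewrite -fE.
rewrite lebesgue_measure_itv/= [RHS]lebesgue_measure_itv/= !lte_fin -!EFinB.
rewrite (_ : (1 - b < 1 - a) = (a < b)); last by rewrite ltrD2l ltrN2.
by case: ifP => // _; congr EFin; ring.
Qed.

Lemma integral_rev01 (D : set R) (f : R -> \bar R) :
  (\int[mu]_(t in D) f t = \int[mu]_(t in rev01 @^-1` D) f (rev01 t))%E.
Proof.
apply: integral_involution; [exact: measurable_rev01|exact: rev01K|].
exact: lebesgue_measure_rev01.
Qed.

Lemma Rintegral_rev01 f :
  \int[mu]_(t in `]0, 1[) f t = \int[mu]_(t in `]0, 1[) f (rev01 t).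
Proof. by rewrite /Rintegral integral_rev01 rev01_oo. Qed.

Lemma is_derive_rev01_comp (g : R -> R) t (dg : R) :
  is_derive (rev01 t : R^o) (1 : R^o) (g : R^o -> R^o) dg ->
  is_derive (t : R^o) (1 : R^o) (g \o rev01 : R^o -> R^o) (- dg).
Proof.
move=> Hg.
have dr : is_derive (t : R^o) (1 : R^o) (rev01 : R^o -> R^o) (-1).
  have := is_deriveB (is_derive_cst (1 : R^o) (t : R^o) (1 : R^o))
    (is_derive_id (t : R^o) (1 : R^o)).
  by move/is_derive_eq; apply; rewrite sub0r.
have := @is_derive1_comp R g rev01 t _ _ Hg dr.
by move/is_derive_eq; apply; rewrite mulrN1.
Qed.

Lemma Ck_on_rev01 k (g : R -> R) : Ck_on [set: R^o] k g ->
  Ck_on [set: R^o] k (g \o rev01).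
Proof.
elim: k g => [|k IH] g /=.
  move=> cg t _; apply: (@continuous_comp R^o R^o R^o).
    exact: rev01_continuous.
  by apply: cg; rewrite inE.
move=> [dg Ckg].
have der t : is_derive (t : R^o) (1 : R^o) (g \o rev01 : R^o -> R^o)
    (- 'D_1 (g : R^o -> R^o) (rev01 t)).
  by apply: is_derive_rev01_comp; split => //; exact: dg.
have diff t : differentiable (g \o rev01 : R^o -> R^o) (t : R^o).
  by apply/derivable1_diffP; have [] := der t.
have diffg t : differentiable (g : R^o -> R^o) (t : R^o).
  by apply/derivable1_diffP; exact: dg.
split => [t v _|v]; first exact: diff_derivable.
(* The sign from the chain rule is absorbed in the direction, so the induction hypothesis applies to
   a directional derivative of [g]. *)
rewrite (_ : 'D_v _ = 'D_(- v) (g : R^o -> R^o) \o rev01); first exact/IH.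
apply/funext => t /=; rewrite deriveE// diff1E// derive1E.
have [_ ->] := der t; rewrite [in RHS]deriveE// [in RHS]diff1E// derive1E.
by rewrite /GRing.scale/= mulrN mulNr.
Qed.

Lemma test_function01_rev01 (phi : R -> R) :
  test_function01 phi -> test_function01 (phi \o rev01).
Proof.
move=> [sphi cphi subphi].
have sub : closure [set t | (phi \o rev01) t != 0] `<=`
    rev01 @^-1` (closure [set t | phi t != 0]).
  have cl : closed (rev01 @^-1` (closure [set t | phi t != 0])).
    apply: closed_comp; last exact: closed_closure.
    by move=> t _; exact: rev01_continuous.
  rewrite [X in _ `<=` X]((closure_id _).1 cl); apply: closure_subset => t nz.
  exact: (@subset_closure _ [set t | phi t != 0]).
have sub01 : closure [set t | (phi \o rev01) t != 0] `<=` `]0, 1[.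
  by move=> t /sub /subphi /=; rewrite rev01_itv.
split => //; first by move=> k; exact: Ck_on_rev01.
have subcc := subset_trans sub01 (@subset_itv_oo_cc _ R 0 1).
apply: subclosed_compact subcc; first exact: closed_closure.
exact: segment_compact.
Qed.

Lemma within_rev01 (T : topologicalType) (g : R -> T) :
  {within `[0, 1], continuous g} -> {within `[0, 1], continuous (g \o rev01)}.
Proof.
move=> /subspace_continuousP cg; apply/subspace_continuousP => t t01.
have r01 : `[0, 1]%classic (rev01 t) by move: t01; rewrite -{1}rev01_cc.
move=> U /= /(cg _ r01) H.
have {}H : nbhs (rev01 t) [set s | `[0, 1]%classic s -> U (g s)] := H.
have {}H : nbhs t [set s | `[0, 1]%classic (rev01 s) -> U (g (rev01 s))] :=
  @rev01_continuous t _ H.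
change (nbhs t [set s | `[0, 1]%classic s -> U (g (rev01 s))]).
by apply: filterS H => s /= H s01; apply: H; rewrite rev01_itv.
Qed.

Lemma locally_integrable_rev01 f :
  locally_integrable `]0, 1[ f -> locally_integrable `]0, 1[ (f \o rev01).
Proof.
move=> [mf o01 lf]; split => //.
  apply: (measurable_comp _ _ mf); first exact: measurable_itv.
    by move=> _ [t t01 <-] /=; rewrite rev01_itv.
  exact: measurable_funTS measurable_rev01.
move=> K K01 cK; rewrite integral_rev01.
(* For an involution preimage and image agree, and the image of a compact set is compact. *)
have -> : rev01 @^-1` K = rev01 @` K.
  apply/seteqP; split => t /=.
    by move=> Kt; exists (rev01 t) => //; rewrite rev01K.
  by move=> [s Ks <-]; rewrite rev01K.
under eq_integral do rewrite /= rev01K.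
apply: lf.
  by move=> _ [s /K01 s01 <-] /=; rewrite rev01_itv.
apply: continuous_compact => //.
by apply: continuous_subspaceT => t; exact: rev01_continuous.
Qed.

(** * Reversal of competitors and symmetry of the graph metric *)

Section graph_reversal.
Context {n : nat} (theta : R -> R -> R) (q : 'M[R]_n.+1).
Implicit Types (p : R -> 'rV[R]_n.+1) (v : R -> 'M[R]_n.+1).

(** The weak equation for the reversed pair is the original one tested against [phi \o rev01]: the
    sign in the derivative of the latter matches the sign of the reversed velocity. *)
Lemma graph_continuity_equation_rev01 p v :
  graph_continuity_equation theta q p v ->
  graph_continuity_equation theta q (p \o rev01) (fun t => - v (rev01 t)).
Proof.
move=> [p01 cp mv lv weak]; split.
- by move=> t t01 /=; apply: p01; rewrite rev01_itv.
- exact: within_rev01.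
- move=> i j; rewrite (_ : (fun _ => _) = (fun t => - v (rev01 t) i j)); last first.
    by apply/funext => t; rewrite mxE.
  apply: measurable_funN; apply: (measurable_comp _ _ (mv i j)) => //.
    by move=> _ [t t01 <-] /=; rewrite rev01_itv.
  exact: measurable_funTS measurable_rev01.
- move=> i j; have := locally_integrableN (locally_integrable_rev01 (lv i j)).
  congr locally_integrable; apply/funext => t /=.
  by rewrite mxE mulrN.
- move=> i phi tphi.
  have := weak i _ (test_function01_rev01 tphi).
  rewrite (Rintegral_rev01 (fun t => p t 0 i * derive1 (phi \o rev01) t)).
  rewrite (Rintegral_rev01 (fun t => 2^-1 * (\sum_j theta (p t 0 i) (p t 0 j) *
    (v t i j - v t j i) * q i j) * (phi \o rev01) t)) => H.
  have dphi t : derive1 (phi \o rev01) (rev01 t) = - derive1 phi t.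
    rewrite derive1E.
    have [sphi _ _] := tphi; have [/(_ t 1 I) dt _] := sphi 1%N.
    have Hd : is_derive (rev01 (rev01 t) : R^o) (1 : R^o) (phi : R^o -> R^o) ('D_1 phi t).
      by rewrite rev01K; split.
    by have [_ ->] := is_derive_rev01_comp Hd; rewrite derive1E.
  rewrite -RintegralN.
  transitivity (\int[mu]_(t in `]0, 1[) (p (rev01 t) 0 i *
     derive1 (phi \o rev01) (rev01 t))).
    by apply: eq_Rintegral => t _; rewrite dphi mulrN.
  apply: (@oppr_inj R); rewrite H -RintegralN; apply: eq_Rintegral => t _ /=.
  rewrite rev01K -mulNr -mulrN -sumrN; congr (_ * _ * _).
  by apply: eq_bigr => j _; rewrite !mxE; ring.
Qed.

Lemma graph_action_rev01 p v :
  graph_action theta q (p \o rev01) (fun t => - v (rev01 t)) =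
  graph_action theta q p v.
Proof.
rewrite /graph_action [RHS]integral_rev01 rev01_cc; apply: eq_integral => t _.
congr (EFin (_ * _)); apply: eq_bigr => i _; apply: eq_bigr => j _.
by rewrite mxE sqrrN.
Qed.

(** Time reversal exchanges the end points of a competitor and keeps its action, so both infima
    range over the same values. *)
Lemma W_graph_sym (p0 p1 : 'rV[R]_n.+1) :
  W_graph theta q p0 p1 = W_graph theta q p1 p0.
Proof.
have sub (a b : 'rV[R]_n.+1) : [set x | exists p v,
    [/\ graph_continuity_equation theta q p v, p 0 = a, p 1 = b &
        x = graph_action theta q p v]] `<=` [set x | exists p v,
    [/\ graph_continuity_equation theta q p v, p 0 = b, p 1 = a &
        x = graph_action theta q p v]].
  move=> _ [p [v [Hpv pa pb ->]]].
  exists (p \o rev01), (fun t => - v (rev01 t)); split.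
  - exact: graph_continuity_equation_rev01.
  - by rewrite /= /rev01 subr0.
  - by rewrite /= /rev01 subrr.
  - by rewrite graph_action_rev01.
by rewrite /W_graph; congr (sqrte (ereal_inf _)); apply/seteqP; split; exact: sub.
Qed.

End graph_reversal.
End time_reversal.

(** * The graph metric is bounded *)

Section edge_flow.
Context {R : realType} {n : nat} (q : 'M[R]_n.+1).

(** [Phi] is a unit flow with source [i] and sink [k], carried by the edges. It is built by
    induction along a path, each edge adding a unit antisymmetric flow; the divergences
    telescope. *)
Lemma edge_flow : symmetric_graph q -> connected_graph q ->
  forall i k, exists Phi : 'M[R]_n.+1,
    [/\ forall a b, Phi a b = - Phi b a,
        forall a b, q a b = 0 -> Phi a b = 0 &
        forall a, \sum_b Phi a b = (a == i)%:R - (a == k)%:R].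
Proof.
move=> hsym hconn i k; have /connectP[s + ->] := hconn i k.
elim: s i => [|x s IH] i /=.
  move=> _; exists 0; split => [a b|a b _|a]; rewrite ?mxE ?oppr0//.
  by rewrite subrr big1// => b _; rewrite mxE.
move=> /andP[qix /IH[Phi [Pa Ps Pd]]].
exists (Phi + delta_mx i x - delta_mx x i); split.
- by move=> a b; rewrite !mxE Pa (andbC (b == i)) (andbC (b == x)); ring.
- move=> a b qab; rewrite !mxE Ps// add0r.
  have [/andP[/eqP ai /eqP bx]|_] := boolP ((a == i) && (b == x)).
    by move: qix; rewrite -ai -bx qab ltxx.
  have [/andP[/eqP ax /eqP bi]|_] := boolP ((a == x) && (b == i)).
    by move: qix; rewrite -ax -bi hsym qab ltxx.
  by rewrite subrr.
- move=> a; have dsum (y z : 'I_n.+1) :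
      \sum_b (delta_mx y z : 'M[R]_n.+1) a b = (a == y)%:R.
    rewrite (bigD1 z)//= big1 ?addr0 => [|b bz]; rewrite mxE ?eqxx ?andbT//.
    by rewrite (negbTE bz) andbF.
  transitivity (\sum_b Phi a b + \sum_b (delta_mx i x : 'M[R]_n.+1) a b -
      \sum_b (delta_mx x i : 'M[R]_n.+1) a b).
    by rewrite -big_split -sumrB; apply: eq_bigr => b _; rewrite !mxE.
  by rewrite Pd !dsum; ring.
Qed.

End edge_flow.

(** * Polynomial curves as competitors *)

Section polynomial_curve.
Context {R : realType} {n : nat} (theta : R -> R -> R) (q : 'M[R]_n.+1).
Variable (P : 'I_n.+1 -> {poly R}).
Notation mu := (@lebesgue_measure R).

Definition poly_curve (t : R) : 'rV[R]_n.+1 := \row_k (P k).[t].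

Hypothesis P01 : forall t, t \in `[0, 1] -> graph_prob (poly_curve t).

Lemma poly_curve_coord_continuous i : continuous (fun t => poly_curve t 0 i).
Proof.
rewrite (_ : (fun _ => _) = horner (P i)); first exact: continuous_horner.
by apply/funext => t; rewrite mxE.
Qed.

Lemma poly_curve_continuous : continuous poly_curve.
Proof.
move=> t; apply: (@differentiable_continuous _ R^o).
apply/derivable1_diffP/derivable_mxP => a b.
rewrite (_ : (fun x : R => poly_curve x a b) = horner (P b)).
  exact: derivable_horner.
by apply/funext => x; rewrite mxE.
Qed.

Lemma horner_integrable (p : {poly R}) (D : set R) :
  measurable D -> D `<=` `[0, 1]%classic -> mu.-integrable D (EFin \o horner p).
Proof.
apply: within_continuous_integrable.
by apply: continuous_subspaceT => x; exact: continuous_horner.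
Qed.

(** Integration by parts; the boundary terms vanish since the support of [phi] lies in the open
    interval. *)
Lemma horner_weak_derivative (p : {poly R}) (phi : R -> R) :
  test_function01 phi ->
  - (\int[mu]_(t in `]0, 1[) (p.[t] * derive1 phi t)) =
  \int[mu]_(t in `]0, 1[) (p^`().[t] * phi t).
Proof.
move=> [sphi _ supp].
have phi0 x : x \notin `]0, 1[ -> phi x = 0.
  move=> x01; apply/eqP; apply: contraNT x01 => nz.
  exact/supp/(@subset_closure _ [set t | phi t != 0]).
have dphi x : derivable (phi : R^o -> R^o) x 1.
  by have [/(_ x 1 I)] := sphi 1%N.
have cphi : continuous phi.
  by move=> x; have /= := sphi 0%N; apply; rewrite inE.
have cdphi : continuous (derive1 phi).
  have [_ /(_ 1)/= cd] := sphi 1%N.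
  have -> : derive1 phi = 'D_1 (phi : R^o -> R^o).
    by apply/funext => x; rewrite derive1E.
  by move=> x; apply: cd; rewrite inE.
have LR (f : R -> R) : continuous f ->
    (forall x, derivable (f : R^o -> R^o) x 1) -> derivable_oo_LRcontinuous f 0 1.
  move=> cf df; split => [x _//| |].
    by apply: cvg_at_right_filter; exact: cf.
  by apply: cvg_at_left_filter; exact: cf.
have := @Rintegration_by_parts R (horner p) phi (horner p^`()) (derive1 phi) 0 1
  ltr01.
have oc (f : R -> R) : continuous f ->
    \int[mu]_(t in `[0, 1]) f t = \int[mu]_(t in `]0, 1[) f t.
  move=> cf; rewrite /Rintegral (integral_itv_bndoo true false)//.
  by apply/measurable_EFinP; apply: measurable_funTS; exact: continuous_measurable_fun.
rewrite !oc; last 2 first.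
- move=> x; apply: continuousM; [exact: continuous_horner | exact: cphi].
- move=> x; apply: continuousM; [exact: continuous_horner | exact: cdphi].
move=> ->.
- by rewrite !phi0 ?in_itv/= ?ltxx ?andbF// !mulr0 subrr sub0r opprK.
- by apply: continuous_subspaceT => x; exact: continuous_horner.
- by apply: LR; [exact: continuous_horner | exact: derivable_horner].
- by move=> x _; rewrite derivE.
- by apply: continuous_subspaceT => x; exact: cdphi.
- exact: LR.
- by move=> x _.
Qed.

(** A polynomial flux is locally integrable, and the pointwise equation on []0, 1[] implies the weak
    one by parts. *)
Lemma poly_curve_continuity_equation (v : R -> 'M[R]_n.+1)
    (F : 'I_n.+1 -> 'I_n.+1 -> {poly R}) :
  (forall i j, measurable_fun (`[0, 1] : set R) (fun t => v t i j)) ->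
  (forall i j t, t \in `]0, 1[ ->
    theta (poly_curve t 0 i) (poly_curve t 0 j) * v t i j = (F i j).[t]) ->
  (forall i t, t \in `]0, 1[ -> 2^-1 * (\sum_j
     theta (poly_curve t 0 i) (poly_curve t 0 j) * (v t i j - v t j i) * q i j) =
     (P i)^`().[t]) ->
  graph_continuity_equation theta q poly_curve v.
Proof.
move=> mv vF divE; split => //.
- by apply: continuous_subspaceT; exact: poly_curve_continuous.
- move=> i j; apply: open_integrable_locally; first exact: itv_open.
  apply: (@eq_integrable _ _ _ mu _ _ (EFin \o horner (F i j))) => //.
    by move=> t; rewrite inE /= => t01; rewrite vF.
  by apply: horner_integrable => //; exact: subset_itv_oo_cc.
- move=> i phi tphi; rewrite -[RHS](_ : \int[mu]_(t in `]0, 1[)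
      ((P i)^`().[t] * phi t) = _); last first.
    by apply: eq_Rintegral => t; rewrite inE /= => t01; rewrite divE.
  rewrite -horner_weak_derivative//; congr (- _).
  by apply: eq_Rintegral => t _; rewrite mxE.
Qed.

End polynomial_curve.

(** The constant curve with zero velocity has zero action. *)
Lemma W_graph_refl (R : realType) (n : nat) (theta : R -> R -> R)
    (q : 'M[R]_n.+1) (p : 'rV[R]_n.+1) :
  graph_prob p -> W_graph theta q p p = 0%E.
Proof.
move=> gp; rewrite /W_graph; set S := [set a | _].
have S0 : S 0%E.
  exists (poly_curve (fun k => (p 0 k)%:P)), (fun=> 0).
  have cE t : poly_curve (fun k => (p 0 k)%:P) t = p.
    by apply/rowP => k; rewrite mxE hornerC.
  split => //.
  - apply: (@poly_curve_continuity_equation _ _ _ _ _ _ _ (fun _ _ => 0)).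
    + by move=> t _; rewrite cE.
    + by move=> i j; exact: measurable_cst.
    + by move=> i j t _; rewrite [X in _ * X]mxE mulr0 horner0.
    + move=> i t _; rewrite derivC horner0 big1 ?mulr0// => j _.
      by rewrite [X in X - _]mxE [X in _ - X]mxE subrr mulr0 mul0r.
  - rewrite /graph_action integral0_eq// => t _.
    rewrite big1 ?mulr0// => i _; rewrite big1// => j _.
    by rewrite [X in X ^+ 2]mxE expr0n/= !mul0r.
apply/eqP; rewrite eq_le sqrte_ge0 andbT -[leRHS](@sqrte0 R) lee_sqrt//.
exact: ereal_inf_lbound.
Qed.

(** The inverse is total with value 0 at 0: continuous off the origin, and the singleton is treated
    apart. *)
Lemma invr_measurable (R : realType) :
  measurable_fun [set: R] (fun x : R => x^-1).
Proof.
rewrite -(setUv [set 0 : R]); apply/measurable_funU => //.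
  exact: measurableC.
split; first exact: measurable_fun_set1.
apply: open_continuous_measurable_fun.
  apply: closed_openC.
  exact: (accessible_closed_set1 (hausdorff_accessible (@Rhausdorff R))).
by move=> x; rewrite inE /= => /eqP x0; exact: inv_continuous.
Qed.

Section graph_diameter.
Context {R : realType} {n : nat} (theta : R -> R -> R) (q : 'M[R]_n.+1).
Hypotheses (Htheta : interpolation_function theta) (hq : weighted_graph q)
  (hsym : symmetric_graph q).
Notation mu := (@lebesgue_measure R).

(** * Action of a curve whose velocity is routed by unit flows *)

Section action_bound.
Variables (P : 'I_n.+1 -> {poly R}) (Phi : 'I_n.+1 -> 'M[R]_n.+1) (c M : R).
Notation p := (poly_curve P).
Hypotheses (P01 : forall t, t \in `[0, 1] -> graph_prob (p t))
  (Psum : forall t, \sum_k (P k)^`().[t] = 0)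
  (c0 : 0 < c) (M0 : 0 <= M)
  (Pge : forall k t, t \in `[0, 1] -> c * (t * (1 - t)) ^+ 2 <= (P k).[t])
  (dPle : forall k t, t \in `[0, 1] -> `|(P k)^`().[t]| <= M * (t * (1 - t)))
  (PhiN : forall k a b, Phi k a b = - Phi k b a)
  (Phi0 : forall k a b, q a b = 0 -> Phi k a b = 0)
  (Phidiv : forall k a, \sum_b Phi k a b = (a == k)%:R - (a == ord0)%:R).

(** The flux through the pair [(i, j)]: the rate of change of each coordinate [k] is sent along the
    unit flow [Phi k] between [k] and the root [ord0]. *)
Let F i j : {poly R} := \sum_k (P k)^`() * (Phi k i j)%:P.

Let FE i j t : (F i j).[t] = \sum_k (P k)^`().[t] * Phi k i j.
Proof. by rewrite horner_sum; apply: eq_bigr => k _; rewrite !hornerE. Qed.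

Let th t i j : R := theta (p t 0 i) (p t 0 j).

(** The velocity realising the flux [F]. Division by zero gives 0 off the edges, where [F] vanishes
    as well. *)
Let v t : 'M[R]_n.+1 := \matrix_(i, j) ((F i j).[t] / (th t i j * q i j)).

Let K i j : R := (M * \sum_k `|Phi k i j|) ^+ 2 / (c * q i j).

Let th_ge i j t : t \in `]0, 1[ -> c * (t * (1 - t)) ^+ 2 <= th t i j.
Proof.
move=> t01; have tc : t \in `[0, 1] by exact: subset_itv_oo_cc t01.
move: t01; rewrite in_itv/= => /andP[t0 t1].
apply: (theta_ge Htheta); rewrite ?mxE ?Pge//.
by rewrite mulr_gt0// exprn_gt0// mulr_gt0// subr_gt0.
Qed.

Let th_gt0 i j t : t \in `]0, 1[ -> 0 < th t i j.
Proof.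
move=> t01; apply: lt_le_trans (th_ge i j t01).
move: t01; rewrite in_itv/= => /andP[t0 t1].
by rewrite mulr_gt0// exprn_gt0// mulr_gt0// subr_gt0.
Qed.

Let F_le i j t : t \in `[0, 1] ->
  `|(F i j).[t]| <= M * (\sum_k `|Phi k i j|) * (t * (1 - t)).
Proof.
move=> t01; rewrite FE; apply: (le_trans (ler_norm_sum _ _ _)).
rewrite mulrAC mulr_sumr; apply: ler_sum => k _.
by rewrite normrM ler_wpM2r// dPle.
Qed.

Let vF i j t : t \in `]0, 1[ -> th t i j * v t i j = (F i j).[t] / q i j.
Proof.
move=> t01; rewrite mxE; have [q0|q0] := eqVneq (q i j) 0.
  by rewrite q0 !(mulr0, invr0).
by field; rewrite q0 gt_eqF// th_gt0.
Qed.

Let vFq i j t : t \in `]0, 1[ -> th t i j * v t i j * q i j = (F i j).[t].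
Proof.
move=> t01; rewrite vF//; have [q0|q0] := eqVneq (q i j) 0.
  by rewrite q0 mulr0 FE big1// => k _; rewrite Phi0// mulr0.
by rewrite divfK.
Qed.

(** The contributions at the root [ord0] add up to the sum of all the derivatives, which is 0; only
    the derivative of coordinate [i] remains. *)
Let F_sum i t : \sum_j (F i j).[t] = (P i)^`().[t].
Proof.
under eq_bigr do rewrite FE.
rewrite exchange_big/=.
under eq_bigr do rewrite -mulr_sumr Phidiv mulrBr.
rewrite sumrB -mulr_suml Psum mul0r subr0 (bigD1 i)//= eqxx mulr1.
rewrite big1 ?addr0// => k ki.
by rewrite eq_sym (negbTE ki) mulr0.
Qed.

Let continuity_eq : graph_continuity_equation theta q p v.
Proof.
apply: (@poly_curve_continuity_equation _ _ _ _ _ _ _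
  (fun i j => F i j * ((q i j)^-1)%:P)) => //.
- move=> i j; rewrite (_ : (fun _ => _) =
      (fun t => (F i j).[t] * (th t i j * q i j)^-1)); last first.
    by apply/funext => t; rewrite mxE.
  have cp i' : {within `[0, 1], continuous (fun t => p t 0 i')}.
    by apply: continuous_subspaceT => t; exact: poly_curve_coord_continuous.
  apply: measurable_funM.
    apply: measurable_funTS; apply: continuous_measurable_fun.
    exact: continuous_horner.
  apply: (measurableT_comp (@invr_measurable R)).
  apply: measurable_funM => //.
  apply: (@subspace_continuous_measurable_fun R `[0, 1]) => //.
  by apply: (theta_within_continuous Htheta) => // t /P01 [].
- by move=> i j t t01; rewrite -/(th t i j) vF// !hornerE.
- move=> i t t01.
  (* The flux is antisymmetric and [theta] and [q] are symmetric, so [v t j i] contributes the same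
     as [v t i j]; the factor 2 cancels the one half of the equation. *)
  have -> : \sum_j theta (p t 0 i) (p t 0 j) * (v t i j - v t j i) * q i j =
      \sum_j 2 * (F i j).[t].
    apply: eq_bigr => j _; rewrite -/(th t i j) mulrBr mulrBl vFq//.
    have tcc : t \in `[0, 1] by exact: subset_itv_oo_cc t01.
    have [p0 _] := P01 tcc.
    have -> : th t i j = th t j i by exact: (theta_sym Htheta).
    rewrite hsym vFq// !FE mulr_sumr -sumrB; apply: eq_bigr => k _.
    by rewrite (PhiN k j i); ring.
  by rewrite -mulr_sumr F_sum; field.
Qed.

(** On an edge the action density is [F^2 / (th q)]. The numerator is at most a multiple of
    [(t (1 - t))^2] and [th] is at least [c (t (1 - t))^2], so the quotient is bounded uniformly in
    time. *)
Let action_le : (graph_action theta q p v <= (2^-1 * \sum_i \sum_j K i j)%:E)%E.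
Proof.
have K0 i j : 0 <= K i j by rewrite divr_ge0 ?sqr_ge0// mulr_ge0 ?hq// ltW.
apply: (@le_trans _ _ (\int[mu]_(t in `[0%R, 1%R])
    (2^-1 * \sum_i \sum_j K i j)%:E)%E); last first.
  rewrite integral_cst//= lebesgue_measure_itv/= lte_fin ltr01.
  by rewrite oppr0 adde0 mule1.
apply: ge0_le_lower_integral => t /(id : _ -> t \in `[0, 1]) t01; rewrite lee_fin.
  rewrite mulr_ge0// sumr_ge0// => i _; rewrite sumr_ge0// => j _.
  have [p0 _] := P01 t01.
  by rewrite mulr_ge0// mulr_ge0 ?sqr_ge0//; exact: (theta_ge0 Htheta).
rewrite ler_wpM2l//; apply: ler_sum => i _; apply: ler_sum => j _.
rewrite -/(th t i j).
(* At the two end points the flux vanishes, hence so does [v], even if [th] is 0 there. *)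
have [w0|w0] := eqVneq (t * (1 - t)) 0.
  have := F_le i j t01; rewrite w0 mulr0 normr_le0 => /eqP F0.
  by rewrite mxE F0 mul0r expr0n/= !mul0r.
have [q0|q0] := eqVneq (q i j) 0; first by rewrite q0 mulr0.
have too : t \in `]0, 1[.
  move: t01 w0; rewrite !in_itv/= mulf_eq0 negb_or subr_eq0.
  by move=> /andP[t0 t1] /andP[nt0 nt1]; rewrite !lt_def nt0 nt1 t0 t1.
have qgt0 : 0 < q i j by rewrite lt_neqAle eq_sym q0 hq.
have thgt0 := th_gt0 i j too.
rewrite mxE (_ : _ * _ * _ = `|(F i j).[t]| ^+ 2 / (th t i j * q i j)); last first.
  by rewrite real_normK ?num_real//; field; rewrite q0 gt_eqF.
rewrite ler_pdivrMr ?mulr_gt0// /K.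
set S := \sum_k _.
have -> : (M * S) ^+ 2 / (c * q i j) * (th t i j * q i j) =
    (M * S) ^+ 2 * (th t i j / c) by field; rewrite q0 gt_eqF.
apply: (@le_trans _ _ ((M * S * (t * (1 - t))) ^+ 2)).
  by rewrite lerXn2r ?nnegrE//; [exact: le_trans (F_le i j t01) | exact: F_le].
rewrite exprMn ler_wpM2l ?sqr_ge0// ler_pdivlMr// mulrC.
exact: th_ge.
Qed.

Lemma W_graph_poly_curve_le :
  (W_graph theta q (p 0) (p 1) ^+ 2 <=
    (2^-1 * \sum_i \sum_j (M * \sum_k `|Phi k i j|) ^+ 2 / (c * q i j))%:E)%E.
Proof.
rewrite /W_graph sqr_sqrte; last first.
  apply: le_ereal_inf_tmp => _ [p' [v' [[p'01 _ _ _ _] _ _ ->]]].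
  apply: integral_ge0 => t /p'01[p0 _]; rewrite lee_fin.
  rewrite mulr_ge0// sumr_ge0// => i _; rewrite sumr_ge0// => j _.
  by rewrite mulr_ge0// mulr_ge0 ?sqr_ge0//; exact: (theta_ge0 Htheta).
by apply: le_trans action_le; apply: ereal_inf_lbound; exists p, v.
Qed.

End action_bound.

(** * An explicit curve through the interior of the simplex *)

Section spreading_curve.
Variables (p0 p1 : 'rV[R]_n.+1).
Hypotheses (Hp0 : graph_prob p0) (Hp1 : graph_prob p1).

Let S : {poly R} := 3%:P * 'X^2 - 2%:P * 'X^3.
(** Summed over the nodes this gives 2, so the total mass of the curve is
    [(1 - s)^2 + s^2 + 2 s (1 - s) = 1]. *)
Let u : R := 2 / n.+1%:R.

(* With [s = 3 t^2 - 2 t^3] the curve goes from [p0] to [p1] through the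
   interior: its speed is [O(t (1 - t))] while its coordinates are at least of
   order [(t (1 - t))^2], so its action density stays bounded. *)
Definition spreading_curve (k : 'I_n.+1) : {poly R} :=
  (1%:P - S) ^+ 2 * (p0 0 k)%:P + S ^+ 2 * (p1 0 k)%:P + S * (1%:P - S) * u%:P.

Let s (t : R) := 3 * t ^+ 2 - 2 * t ^+ 3.

Let SE t : S.[t] = s t.
Proof. by rewrite /S hornerD hornerN !hornerCM !hornerXn. Qed.

Let dSE t : S^`().[t] = 6 * (t * (1 - t)).
Proof.
rewrite /S derivB !deriv_mulC !derivXn hornerD hornerN.
by rewrite !hornerCM !hornerMn !hornerXn /=; ring.
Qed.

Lemma spreading_curveE k t : (spreading_curve k).[t] =
  (1 - s t) ^+ 2 * p0 0 k + s t ^+ 2 * p1 0 k + s t * (1 - s t) * u.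
Proof.
rewrite /spreading_curve; have := SE t; move: S => X XE.
by rewrite !(hornerD, hornerN, hornerM, hornerC, horner_exp) XE.
Qed.

Lemma deriv_spreading_curve k t : (spreading_curve k)^`().[t] =
  6 * (t * (1 - t)) * (- 2 * (1 - s t) * p0 0 k + 2 * s t * p1 0 k +
    (1 - 2 * s t) * u).
Proof.
rewrite /spreading_curve; move: (SE t) (dSE t); move: S => X XE dXE.
rewrite !expr2 !derivD !derivM !derivB !derivC !mulr0 !addr0.
by rewrite !(hornerD, hornerN, hornerM, hornerC) XE dXE; ring.
Qed.

Let s01 t : t \in `[0, 1] -> 0 <= s t <= 1.
Proof.
rewrite in_itv/= => /andP[t0 t1]; apply/andP; split.
  rewrite (_ : s t = t ^+ 2 * (3 - 2 * t)); last by rewrite /s; ring.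
  by rewrite mulr_ge0 ?sqr_ge0//; lra.
rewrite -subr_ge0 (_ : 1 - s t = (1 - t) ^+ 2 * (1 + 2 * t)); last by rewrite /s; ring.
by rewrite mulr_ge0 ?sqr_ge0//; lra.
Qed.

Let u0 : 0 < u. Proof. by rewrite divr_gt0. Qed.
Let u2 : u <= 2.
Proof. by rewrite ler_pdivrMr// ler_peMr// ler1n. Qed.

Let usum : \sum_(k < n.+1) u = 2.
Proof. by rewrite sumr_const card_ord -[u *+ _]mulr_natr divfK. Qed.

Lemma spreading_curve_prob t : t \in `[0, 1] ->
  graph_prob (poly_curve spreading_curve t).
Proof.
move=> /s01/andP[s0 s1]; have [q0 q1] := Hp0; have [r0 r1] := Hp1; split.
  move=> k; rewrite mxE spreading_curveE !addr_ge0// mulr_ge0 ?sqr_ge0//.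
    by rewrite mulr_ge0// subr_ge0.
  exact: ltW.
under eq_bigr do rewrite mxE spreading_curveE.
have := usum; move: (u) => y ysum.
rewrite !big_split/= -!mulr_sumr q1 r1 ysum; ring.
Qed.

Lemma spreading_curve_deriv_sum t : \sum_k (spreading_curve k)^`().[t] = 0.
Proof.
have [_ q1] := Hp0; have [_ r1] := Hp1.
under eq_bigr do rewrite deriv_spreading_curve.
have := usum; move: (u) => y ysum.
rewrite -mulr_sumr !big_split/= -!mulr_sumr q1 r1 ysum; ring.
Qed.

Lemma spreading_curve_ge k t : t \in `[0, 1] ->
  u * (t * (1 - t)) ^+ 2 <= (spreading_curve k).[t].
Proof.
move=> t01; have [q0 _] := Hp0; have [r0 _] := Hp1.
have /andP[s0 s1] := s01 t01; move: t01; rewrite in_itv/= => /andP[t0 t1].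
rewrite spreading_curveE -[leLHS]add0r lerD//.
  by rewrite addr_ge0// mulr_ge0 ?sqr_ge0.
rewrite mulrC ler_wpM2r ?(ltW u0)//.
(* From [s = t^2 (3 - 2 t)] and [1 - s = (1 - t)^2 (1 + 2 t)]; the remaining factor is at least 1 on
   [[0, 1]]. *)
rewrite (_ : s t * (1 - s t) =
  (t * (1 - t)) ^+ 2 * ((3 - 2 * t) * (1 + 2 * t))); last by rewrite /s; ring.
by rewrite ler_peMr ?sqr_ge0//; nra.
Qed.

Lemma spreading_curve_deriv_le k t : t \in `[0, 1] ->
  `|(spreading_curve k)^`().[t]| <= 36 * (t * (1 - t)).
Proof.
move=> t01; have /andP[s0 s1] := s01 t01.
have [q0 q1] := Hp0; have [r0 r1] := Hp1.
have qk1 : p0 0 k <= 1 by rewrite -q1 (bigD1 k)//= lerDl sumr_ge0.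
have rk1 : p1 0 k <= 1 by rewrite -r1 (bigD1 k)//= lerDl sumr_ge0.
have qk0 := q0 k; have rk0 := r0 k.
move: t01; rewrite in_itv/= => /andP[t0 t1].
rewrite deriv_spreading_curve normrM ger0_norm; last first.
  by rewrite !mulr_ge0// subr_ge0.
(* One factor 6 comes from the derivative of [s], the other is a crude bound on the bracket. *)
rewrite (_ : 36 * _ = 6 * (t * (1 - t)) * 6); last by ring.
rewrite ler_wpM2l ?mulr_ge0 ?subr_ge0//.
move: (s t) (p0 0 k) (p1 0 k) s0 s1 qk0 qk1 rk0 rk1 => x a b x0 x1 a0 a1 b0 b1.
have := u0; have := u2; move: u => y y2 y0.
have h1 : 0 <= (1 - x) * a <= 1 by apply/andP; split; nra.
have h2 : 0 <= x * b <= 1 by apply/andP; split; nra.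
have h3 : 0 <= x * y <= 2 by apply/andP; split; nra.
rewrite ler_norml (_ : - 2 * (1 - x) * a + 2 * x * b + (1 - 2 * x) * y =
  - 2 * ((1 - x) * a) + 2 * (x * b) + y - 2 * (x * y)); last by ring.
move: ((1 - x) * a) (x * b) (x * y) h1 h2 h3 => h1 h2 h3 *.
by apply/andP; split; lra.
Qed.

Lemma spreading_curve0 : poly_curve spreading_curve 0 = p0.
Proof.
by apply/rowP => k; rewrite mxE spreading_curveE /s !expr0n/=; ring.
Qed.

Lemma spreading_curve1 : poly_curve spreading_curve 1 = p1.
Proof.
by apply/rowP => k; rewrite mxE spreading_curveE /s !expr1n/=; ring.
Qed.

End spreading_curve.

Lemma W_graph_sqr_le : connected_graph q -> exists C : R,
  forall p0 p1, graph_prob p0 -> graph_prob p1 ->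
  (W_graph theta q p0 p1 ^+ 2 <= C%:E)%E.
Proof.
move=> hconn.
have [Phi PhiP] := choice (fun k => edge_flow hsym hconn k ord0).
(* The constant is read off the bound for the curve; it involves only [q], [n] and the flows [Phi],
   chosen before the end points. *)
eexists => p0 p1 Hp0 Hp1.
rewrite -[X in W_graph _ _ X](spreading_curve0 p0 p1).
rewrite -[X in W_graph _ _ _ X](spreading_curve1 p0 p1).
apply: (@W_graph_poly_curve_le _ Phi (2 / n.+1%:R) 36) => //.
- by move=> t t01; exact: spreading_curve_prob.
- by move=> t; exact: spreading_curve_deriv_sum.
- by move=> k t t01; exact: spreading_curve_ge.
- by move=> k t t01; exact: spreading_curve_deriv_le.
- by move=> k; have [] := PhiP k.
- by move=> k; have [] := PhiP k.
- by move=> k; have [] := PhiP k.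
Qed.

End graph_diameter.

(** * Lipschitz functions determine finite measures *)

Section borel_measurability.
Context {R : realType}.

Lemma continuous_borel_measurable (V : ptopologicalType) (f : V -> R) :
  continuous f -> measurable_fun [set: borel V] (f : borel V -> R).
Proof.
move=> /continuousP cf.
apply: (measurability _ (RGenOpens.measurableE R)).
move=> _ [_ [a [b ->] <-]]; rewrite setTI.
by apply: sub_sigma_algebra; apply: cf; exact: itv_open.
Qed.

End borel_measurability.

(** * Bounded Lipschitz functions separate finite measures *)

Section lipschitz_unique.
Context {R : realType} {d : nat}.
Notation V := 'rV[R]_d.

(** The norm here is the sup norm, which is below the Euclidean one occurring in the cost. *)
Definition lipschitz01 (eta : V -> R) (L : R) : Prop :=
  (forall x, 0 <= eta x <= 1) /\ (forall x y, `|eta x - eta y| <= L * `|x - y|).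

Lemma lipschitz01_continuous eta L : lipschitz01 eta L ->
  continuous (eta : V -> R^o).
Proof.
move=> [_ lip] x.
apply/(@cvgrPdist_le _ _ _ _ (nbhs_filter (x : V))) => e e0.
(* A majorant of [L] by which one may divide, whatever the sign of [L]. *)
have L1 : 0 < `|L| + 1 by rewrite ltr_wpDl.
near=> y; apply: (le_trans (lip x y)).
apply: (@le_trans _ _ ((`|L| + 1) * `|x - y|)).
  by rewrite ler_wpM2r// (le_trans (ler_norm _))// lerDl.
rewrite mulrC -ler_pdivlMr//; near: y; apply/nbhs_ballP.
exists (e / (`|L| + 1)); first exact: divr_gt0.
by move=> y; rewrite -ball_normE => /ltW.
Unshelve. all: by end_near. Qed.

Section distance_to_set.
Variables (F : set V) (a : V).
Hypothesis Fa : F a.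

(** The hypothesis [Fa] keeps the infimum away from its default value on the empty set. *)
Definition set_dist (x : V) : R := inf [set `|x - y| | y in F].

Let has_inf_dist x : has_inf [set `|x - y| | y in F].
Proof.
split; first by exists `|x - a|, a.
by exists 0 => _ [y _ <-].
Qed.

Lemma set_dist_ge0 x : 0 <= set_dist x.
Proof. by apply: lb_le_inf; [case: (has_inf_dist x) | move=> _ [y _ <-]]. Qed.

Lemma set_dist0 x : F x -> set_dist x = 0.
Proof.
move=> Fx; apply/eqP; rewrite eq_le set_dist_ge0 andbT.
by apply: ge_inf; [case: (has_inf_dist x) | exists x => //; rewrite subrr normr0].
Qed.

Lemma set_dist_gt0 x : closed F -> ~ F x -> 0 < set_dist x.
Proof.
move=> cF nFx; have : nbhs x (~` F) by apply: open_nbhs_nbhs; split => //; exact: closed_openC.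
move=> /nbhs_ballP[r /= r0 rF]; apply: (lt_le_trans r0).
apply: lb_le_inf; first by case: (has_inf_dist x).
move=> _ [y Fy <-]; rewrite leNgt; apply/negP => xy.
by apply: (rF y) => //; rewrite -ball_normE.
Qed.

Lemma set_dist_lipschitz x y : `|set_dist x - set_dist y| <= `|x - y|.
Proof.
have le u w : set_dist u <= `|u - w| + set_dist w.
  rewrite -lerBlDl; apply: lb_le_inf; first by case: (has_inf_dist w).
  move=> _ [z Fz <-]; rewrite lerBlDl.
  have : set_dist u <= `|u - z|.
    by apply: ge_inf; [case: (has_inf_dist u) | exists z].
  by move/le_trans; apply; rewrite -[u - z](subrKA w) ler_normD.
rewrite ler_norml; apply/andP; split.
  by have := le y x; rewrite (distrC y x); lra.
by have := le x y; lra.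
Qed.

End distance_to_set.

Lemma lipschitz_measure_unique
    (m1 m2 : {finite_measure set (borel V) -> \bar R}) :
  (forall eta L, lipschitz01 eta L ->
    (\int[m1]_x (eta x)%:E = \int[m2]_x (eta x)%:E)%E) ->
  forall A : set (borel V), measurable A -> m1 A = m2 A.
Proof.
move=> H.
have HT : m1 setT = m2 setT.
  have := H (fun=> 1) 0; rewrite !integral_cst// !mul1e; apply.
  by split => [x|x y]; rewrite ?ler01 ?lexx// subrr normr0 mul0r.
apply: (@measure_unique _ R (borel V) (@open V) (fun=> setT)) => //.
- exact: openI.
- by move=> _; exact: openT.
- by rewrite bigcup_const//; exists 0%N.
(* The whole space is set apart, since its complement is empty and has no distance function. *)
- move=> U oU; have [->//|/eqP UT] := eqVneq U setT.
  have [a Fa] : exists a, (~` U) a.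
    by apply/existsNP => UA; apply: UT; apply/seteqP; split.
  pose eta (k : nat) x : R := Num.min 1 (k%:R * set_dist (~` U) x).
  have eta01 k x : 0 <= eta k x <= 1.
    by rewrite le_min ler01 ge_min lexx mulr_ge0//; exact: (set_dist_ge0 Fa).
  have lip k : lipschitz01 (eta k) k%:R.
    split => // x y; rewrite /eta.
    have D := set_dist_lipschitz Fa x y.
    have : `|k%:R * set_dist (~` U) x - k%:R * set_dist (~` U) y| <= k%:R * `|x - y|.
      by rewrite -mulrBr normrM ger0_norm// ler_wpM2l.
    move: (k%:R * _) (k%:R * _) (k%:R * _) => p1 p2 p3; rewrite !ler_norml.
    move=> /andP[? ?]; rewrite /Num.min; do 2 case: ifPn; rewrite -?leNgt => *;
      apply/andP; split; lra.
  have meta k : measurable_fun [set: borel V] (fun x : borel V => (eta k x)%:E).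
    apply/measurable_EFinP; apply: continuous_borel_measurable.
    exact: lipschitz01_continuous (lip k).
  (* The sequence is eventually constant: always 0 outside [U], and 1 inside once [k] exceeds the
     inverse of the distance. *)
  have etalim x : limn (fun k => (eta k x)%:E) = (\1_U x)%:E.
    apply/cvg_lim => //; apply: cvg_near_cst.
    rewrite indicE; have [Ux|nUx] := boolP (x \in U); last first.
      near=> k; rewrite /eta (set_dist0 Fa); last by move=> /mem_set; exact/negP.
      by rewrite mulr0 min_r.
    have dx : 0 < set_dist (~` U) x.
      apply: (set_dist_gt0 Fa); first exact: open_closedC.
      by apply; exact: set_mem.
    near=> k; rewrite /eta min_l//.
    rewrite -ler_pdivrMr// mul1r; near: k; exact: nbhs_infty_ger.
  have mono (m : {finite_measure set (borel V) -> \bar R}) :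
      m U = limn (fun k => \int[m]_x (eta k x)%:E)%E.
    rewrite -monotone_convergence//.
    - under eq_integral do rewrite etalim.
      by rewrite integral_indic ?setIT//; exact: sub_sigma_algebra.
    - by move=> k x _; rewrite lee_fin; case/andP: (eta01 k x).
    - move=> x _ k l kl; rewrite lee_fin /eta le_min2//.
      by rewrite ler_wpM2r ?ler_nat// (set_dist_ge0 Fa).
  transitivity (limn (fun k => \int[m1]_x (eta k x)%:E)%E); first exact: mono.
  rewrite (_ : (fun _ => _) = fun k => \int[m2]_x (eta k x)%:E)%E; last first.
    by apply/funext => k; exact: H (lip k).
  by apply/esym; exact: mono.
- by move=> k; exact: fin_num_fun_lty.
Unshelve. all: by end_near. Qed.

End lipschitz_unique.

(** * Lifted measures and couplings *)

Section simplex_facts.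
Context {R : realType} {n : nat}.
Implicit Types r : simplex R n.

Lemma simplex_prob_lift r i : simplex_prob r 0 (lift ord_max i) = set_val r 0 i.
Proof. by rewrite mxE liftK. Qed.

Lemma simplex_prob_max r : simplex_prob r 0 ord_max = 1 - \sum_i set_val r 0 i.
Proof. by rewrite mxE unlift_none. Qed.

Lemma sum_ord_lift_max (f : 'I_n.+1 -> R) :
  \sum_j f j = \sum_i f (lift ord_max i) + f ord_max.
Proof.
rewrite big_ord_recr/=; congr (_ + _); apply: eq_bigr => i _; congr f.
by apply/val_inj; rewrite /= /bump leqNgt ltn_ord add0n.
Qed.

Lemma simplex_prob_graph_prob r : graph_prob (simplex_prob r).
Proof.
have [r0 r1] : simplex_set (set_val r) by exact: (set_mem (svalP r)).
split=> [j|].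
  have [i ->|->] := unliftP ord_max j; first by rewrite simplex_prob_lift.
  by rewrite simplex_prob_max subr_ge0.
rewrite sum_ord_lift_max simplex_prob_max.
under eq_bigr do rewrite simplex_prob_lift.
by rewrite addrC subrK.
Qed.

Lemma simplex_coord_continuous i :
  continuous (fun r : simplex R n => set_val r 0 i).
Proof.
have cval : continuous (set_val : simplex R n -> 'rV[R]_n).
  exact: (@initial_continuous _ _ (set_val : simplex R n -> 'rV[R]_n)).
move=> r.
apply: (@continuous_comp _ _ _ (set_val : simplex R n -> 'rV[R]_n)
  (fun M : 'rV[R]_n => M 0 i)); first exact: cval.
exact: coord_continuous.
Qed.

Lemma simplex_prob_measurable j :
  measurable_fun [set: borel (simplex R n)] (fun r => simplex_prob r 0 j).
Proof.
have mc i : measurable_fun [set: borel (simplex R n)]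
    (fun r : borel (simplex R n) => set_val r 0 i).
  exact: (continuous_borel_measurable (@simplex_coord_continuous i)).
have [i ->|->] := unliftP ord_max j.
  by rewrite (_ : (fun _ => _) = fun r => set_val r 0 i)//; apply/funext => r;
    rewrite simplex_prob_lift.
rewrite (_ : (fun _ => _) = fun r => 1 - \sum_i set_val r 0 i); last first.
  by apply/funext => r; rewrite simplex_prob_max.
apply: measurable_funB; first exact: measurable_cst.
by apply: measurable_sum => i.
Qed.

Lemma simplex_vertex_subproof (j : 'I_n.+1) :
  (\row_i (lift ord_max i == j)%:R : 'rV[R]_n) \in @simplex_set R n.
Proof.
rewrite inE; split => [i|]; first by rewrite mxE ler0n.
have : \sum_k (k == j)%:R = 1 :> R.
  by rewrite (bigD1 j)//= eqxx big1 ?addr0// => k /negbTE ->.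
rewrite sum_ord_lift_max => S1; rewrite -[leRHS]S1.
by under eq_bigr do rewrite mxE; rewrite lerDl ler0n.
Qed.

(** For [j = ord_max] this is the origin: the whole mass sits on the dependent coordinate. *)
Definition simplex_vertex (j : 'I_n.+1) : simplex R n :=
  exist (fun w => w \in @simplex_set R n) _ (simplex_vertex_subproof j).

Lemma simplex_vertexE j k : simplex_prob (simplex_vertex j) 0 k = (k == j)%:R.
Proof.
have E i : set_val (simplex_vertex j) 0 i = (lift ord_max i == j)%:R by rewrite mxE.
have [i ->|->] := unliftP ord_max k; first by rewrite simplex_prob_lift E.
rewrite simplex_prob_max.
have : \sum_k (k == j)%:R = 1 :> R.
  by rewrite (bigD1 j)//= eqxx big1 ?addr0// => k' /negbTE ->.
rewrite sum_ord_lift_max => S1; rewrite -[X in X - _]S1.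
by rewrite (eq_bigr _ (fun i _ => E i)) addrC addKr.
Qed.

End simplex_facts.

(** * Lifting a vector measure to the vertices *)

Section vertex_lift.
Context {R : realType} {d n : nat}.
Notation X := (borel 'rV[R]_d).
Notation Z := (lifted_space R d n).
Variable mu : vector_measure R d n.

Definition vertex_emb (j : 'I_n.+1) (x : X) : Z := (x, simplex_vertex j).

Lemma measurable_vertex_emb j : measurable_fun [set: X] (vertex_emb j).
Proof. by apply: measurable_fun_pair. Qed.

(** The witness is the sum over [j] of [mu j] placed at the vertex [e_j], the image of [mu j] under
    [vertex_emb j]. Its total mass is 1 by [vector_prob]. *)
Lemma vertex_lift_exists : vector_prob mu -> exists l : probability Z R,
  forall f : Z -> \bar R, (forall z, 0 <= f z)%E -> measurable_fun setT f ->
  (\int[l]_z f z = \sum_j \int[mu j]_x f (x, simplex_vertex j))%E.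
Proof.
move=> mu1.
have mex j : exists m : {measure set Z -> \bar R},
    forall A, m A = mu j (vertex_emb j @^-1` A).
  unshelve eexists (pushforward (mu j) (vertex_emb j)); last by [].
  exact: measurable_vertex_emb.
have [m mE] := choice mex.
(* [msum] runs over the naturals below [n.+1], whence the passage through [inord]. *)
have mT : msum (fun k => m (inord k)) n.+1 setT = 1%E.
  by rewrite -mu1 /msum; apply: eq_bigr => k _; rewrite mE inord_val.
pose l : probability Z R := HB.pack (msum (fun k => m (inord k)) n.+1)
  (Measure_isProbability.Build _ _ _ _ mT).
exists l => f f0 mf.
transitivity (\int[msum (fun k => m (inord k)) n.+1]_z f z)%E; first by [].
rewrite ge0_integral_measure_sum//; apply: eq_bigr => k _.
rewrite inord_val.
have mkE A : measurable A -> m k A = mu k (vertex_emb k @^-1` A) by rewrite mE.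
exact: (ge0_integral_image_measure (measurable_vertex_emb k) mkE).
Qed.

End vertex_lift.

(** * Projection of the vertex lift *)

Section projections.
Context {R : realType} {d n : nat}.
Notation X := (borel 'rV[R]_d).
Notation Z := (lifted_space R d n).
Implicit Types (mu nu : vector_measure R d n) (l : probability Z R).

Definition vertex_lift mu l := forall f : Z -> \bar R, (forall z, 0 <= f z)%E ->
  measurable_fun setT f ->
  (\int[l]_z f z = \sum_j \int[mu j]_x f (x, simplex_vertex j))%E.

Lemma measurable_weighted (j : 'I_n.+1) (eta : 'rV[R]_d -> R^o) :
  continuous eta ->
  measurable_fun [set: Z] (fun z : Z => simplex_prob z.2 0 j * eta z.1).
Proof.
move=> ceta; apply: measurable_funM.
  exact: measurableT_comp (simplex_prob_measurable j) _.
by apply: (measurableT_comp (continuous_borel_measurable ceta)).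
Qed.

(** The weight [simplex_prob] at the vertex [e_k] is 1 on coordinate [k] and 0 elsewhere, so only
    [mu j] is left. Positive and negative parts are treated apart because [vertex_lift] speaks of
    nonnegative functions. *)
Lemma vertex_lift_projects_to mu l : vertex_lift mu l -> projects_to l mu.
Proof.
move=> lE j eta ceta _; rewrite [LHS]integralE [RHS]integralE.
have mF : measurable_fun setT (fun z : Z => (simplex_prob z.2 0 j * eta z.1)%:E).
  by apply/measurable_EFinP; exact: measurable_weighted.
rewrite !lE; [|exact: funeneg_ge0|exact: measurable_funeneg
  |exact: funepos_ge0|exact: measurable_funepos].
congr (_ - _)%E.
- rewrite (bigD1 j)//= big1 ?adde0 => [|k kj].
    by apply: eq_integral => x _; rewrite !funeposE /= simplex_vertexE eqxx mul1r.
  rewrite integral0_eq// => x _.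
  by rewrite funeposE /= simplex_vertexE eq_sym (negbTE kj) mul0r maxxx.
- rewrite (bigD1 j)//= big1 ?adde0 => [|k kj].
    by apply: eq_integral => x _; rewrite !funenegE /= simplex_vertexE eqxx mul1r.
  rewrite integral0_eq// => x _.
  by rewrite funenegE /= simplex_vertexE eq_sym (negbTE kj) mul0r /= oppr0 maxxx.
Qed.

Lemma eq_projects_to mu nu l :
  (forall i (A : set X), measurable A -> mu i A = nu i A) ->
  projects_to l mu -> projects_to l nu.
Proof.
move=> munu pl j eta ceta beta; rewrite -pl//.
apply: eq_measure_integral => A mA _; apply/esym; exact: munu.
Qed.

End projections.

(** * Marginals, swaps and diagonal couplings *)

Section couplings.
Context {disp : measure_display} {T : measurableType disp} {R : realType}.
Implicit Types (l : probability T R) (g : probability (T * T)%type R).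
Local Open Scope ereal_scope.

Lemma coupling_integral_fst l1 l2 g (f : T -> \bar R) :
  is_coupling l1 l2 g -> measurable_fun setT f ->
  \int[g]_z f z.1 = \int[l1]_x f x.
Proof.
move=> gl mf.
have ge0 (h : T -> \bar R) : (forall x, 0 <= h x) -> measurable_fun setT h ->
    \int[g]_z h z.1 = \int[l1]_x h x.
  move=> h0 mh; apply/esym.
  apply: (ge0_integral_image_measure (@measurable_fst _ _ T T)) => // A mA.
  by have [H _] := gl A mA; exact/esym/H.
have posE := ge0 _ (fun x => funepos_ge0 f x) (measurable_funepos mf).
have negE := ge0 _ (fun x => funeneg_ge0 f x) (measurable_funeneg mf).
rewrite integralE [RHS]integralE -posE -negE; congr (_ - _).
  by apply: eq_integral => z _; rewrite !funeposE.
by apply: eq_integral => z _; rewrite !funenegE.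
Qed.

(** Only an inequality is claimed, as [f] will be a cost not known to be measurable. *)
Lemma coupling_swap l1 l2 g : is_coupling l1 l2 g ->
  exists2 g' : probability (T * T)%type R, is_coupling l2 l1 g' &
    forall f : T * T -> \bar R, (forall z, 0 <= f z) ->
    \int[g']_z f z <= \int[g]_z f (z.2, z.1).
Proof.
move=> gl.
pose s : {mfun (T * T)%type >-> (T * T)%type} :=
  HB.pack (fun z : T * T => (z.2, z.1)) (isMeasurableFun.Build _ _ _ _ _
  (measurable_fun_pair (@measurable_snd _ _ T T) (@measurable_fst _ _ T T))).
exists (distribution g s) => [A mA|f f0].
  by have [? ?] := gl A mA; split.
by apply: (ge0_lower_integral_image_measure (phi := s)) => //; exact: measurable_funP.
Qed.

Lemma coupling_integral_snd l1 l2 g (f : T -> \bar R) :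
  is_coupling l1 l2 g -> measurable_fun setT f ->
  \int[g]_z f z.2 = \int[l2]_x f x.
Proof.
move=> gl mf.
have ge0 (h : T -> \bar R) : (forall x, 0 <= h x) -> measurable_fun setT h ->
    \int[g]_z h z.2 = \int[l2]_x h x.
  move=> h0 mh; apply/esym.
  apply: (ge0_integral_image_measure (@measurable_snd _ _ T T)) => // A mA.
  by have [_ H] := gl A mA; exact/esym/H.
have posE := ge0 _ (fun x => funepos_ge0 f x) (measurable_funepos mf).
have negE := ge0 _ (fun x => funeneg_ge0 f x) (measurable_funeneg mf).
rewrite integralE [RHS]integralE -posE -negE; congr (_ - _).
  by apply: eq_integral => z _; rewrite !funeposE.
by apply: eq_integral => z _; rewrite !funenegE.
Qed.

(** The image of [l] under the diagonal map; once more a bound from above is enough for the cost. *)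
Lemma coupling_diagonal l : exists2 g : probability (T * T)%type R,
  is_coupling l l g &
  forall f : T * T -> \bar R, (forall z, 0 <= f z) ->
  \int[g]_z f z <= \int[l]_x f (x, x).
Proof.
pose s : {mfun T >-> (T * T)%type} :=
  HB.pack (fun x : T => (x, x)) (isMeasurableFun.Build _ _ _ _ _
  (measurable_fun_pair (@measurable_id _ T setT) (@measurable_id _ T setT))).
exists (distribution l s) => [A mA|f f0]; first by split.
by apply: (ge0_lower_integral_image_measure (phi := s)) => //; exact: measurable_funP.
Qed.

Lemma coupling_product l1 l2 : exists g : probability (T * T)%type R,
  is_coupling l1 l2 g.
Proof.
have T1 l : l setT = 1 by exact: probability_setT.
exists (l1 \x l2)%E => A mA; split.
  have -> : fst @^-1` A = A `*` [set: T] by apply/seteqP; split => z //= [].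
  apply: (eq_trans (product_measure1E l1 l2 mA measurableT)).
  by rewrite -[RHS]mule1; congr (_ * _); exact: T1.
have -> : snd @^-1` A = [set: T] `*` A by apply/seteqP; split => z //= [].
apply: (eq_trans (product_measure1E l1 l2 measurableT mA)).
by rewrite -[RHS]mul1e; congr (_ * _); exact: T1.
Qed.

Lemma wasserstein2_le (c : T -> T -> \bar R) l1 l2 g : is_coupling l1 l2 g ->
  wasserstein2 c l1 l2 <= sqrte (\int[g]_z (c z.1 z.2 ^+ 2)).
Proof.
move=> gl; rewrite lee_sqrt; last first.
  by apply: integral_ge0 => z _; rewrite sqre_ge0.
by apply: ereal_inf_lbound; exists g.
Qed.

(** The one-sided bound for swapped couplings, applied in both directions, gives equality of the
    infima. *)
Lemma wasserstein2_sym (c : T -> T -> \bar R) l1 l2 :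
  (forall x y, c x y = c y x) -> wasserstein2 c l1 l2 = wasserstein2 c l2 l1.
Proof.
move=> csym.
have le m1 m2 : ereal_inf [set \int[g]_z (c z.1 z.2 ^+ 2) | g in is_coupling m1 m2]
    <= ereal_inf [set \int[g]_z (c z.1 z.2 ^+ 2) | g in is_coupling m2 m1].
  apply: le_ereal_inf_tmp => _ [g /coupling_swap[g' g'l g'g] <-].
  apply: (@le_trans _ _ (\int[g']_z (c z.1 z.2 ^+ 2))).
    by apply: ereal_inf_lbound; exists g'.
  apply: (le_trans (g'g _ _)) => [z|]; first by rewrite sqre_ge0.
  by rewrite le_eqVlt; apply/orP; left; apply/eqP; apply: eq_integral => z _ /=;
    rewrite csym.
by rewrite /wasserstein2; congr sqrte; apply/eqP; rewrite eq_le !le.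
Qed.

End couplings.

(** * The lifted distance *)

Section euclidean_norm.
Context {R : realType} {d : nat}.
Implicit Types x y : 'rV[R]_d.

Lemma enorm_sqr x : enorm x ^+ 2 = \sum_i x 0 i ^+ 2.
Proof. by rewrite sqr_sqrtr// sumr_ge0// => i _; rewrite sqr_ge0. Qed.

Lemma enorm_distC x y : enorm (x - y) = enorm (y - x).
Proof.
rewrite /enorm; congr Num.sqrt; apply: eq_bigr => i _.
by rewrite !mxE -sqrrN opprB.
Qed.

Lemma norm_le_enorm x : `|x| <= enorm x.
Proof.
rewrite [`|x|]mx_normrE; apply: bigmax_le => [|[i j] _/=]; first exact: sqrtr_ge0.
rewrite (ord1 i) -sqrtr_sqr ler_sqrt; last first.
  by rewrite sumr_ge0// => k _; rewrite sqr_ge0.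
by rewrite (bigD1 j)//= lerDl sumr_ge0// => k _; rewrite sqr_ge0.
Qed.

(** Coordinatewise this is [(x_i + y_i)^2 >= 0]; the variables are separated, so second moments
    suffice to integrate it. *)
Lemma enorm_sub_sqr_le x y :
  enorm (x - y) ^+ 2 <= enorm x ^+ 2 + enorm x ^+ 2 + (enorm y ^+ 2 + enorm y ^+ 2).
Proof.
rewrite !enorm_sqr -!big_split/=; apply: ler_sum => i _.
by rewrite !mxE; have := sqr_ge0 (x 0 i + y 0 i); nra.
Qed.

Lemma coord_borel_measurable i :
  measurable_fun [set: borel 'rV[R]_d] (fun x : 'rV[R]_d => x 0 i).
Proof. by apply: continuous_borel_measurable; exact: coord_continuous. Qed.

Lemma enorm_sqr_measurable :
  measurable_fun [set: borel 'rV[R]_d] (fun x : 'rV[R]_d => enorm x ^+ 2).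
Proof.
rewrite (_ : (fun _ => _) = fun x : 'rV[R]_d => \sum_i x 0 i ^+ 2); last first.
  by apply/funext => x; exact: enorm_sqr.
by apply: measurable_sum => i; apply: measurable_funX; exact: coord_borel_measurable.
Qed.

End euclidean_norm.

(** * Symmetry, finiteness and separation *)

Section lifted_distance.
Context {R : realType} {d n : nat} (theta : R -> R -> R) (q : 'M[R]_n.+1).
Hypotheses (Htheta : interpolation_function theta) (hq : weighted_graph q)
  (hsym : symmetric_graph q).
Notation Z := (lifted_space R d n).
Notation X := (borel 'rV[R]_d).
Implicit Types (l : probability Z R) (mu nu : vector_measure R d n).
Local Open Scope ereal_scope.

Lemma lifted_dist_sqr (z w : Z) : lifted_dist theta q z w ^+ 2 =
  (enorm ((z.1 : 'rV[R]_d) - w.1) ^+ 2)%:E + simplex_dist theta q z.2 w.2 ^+ 2.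
Proof. by rewrite sqr_sqrte// adde_ge0 ?sqre_ge0// lee_fin sqr_ge0. Qed.

Lemma lifted_dist_sym (z w : Z) : lifted_dist theta q z w = lifted_dist theta q w z.
Proof. by rewrite /lifted_dist enorm_distC /simplex_dist W_graph_sym. Qed.

Lemma lifted_dist_refl (z : Z) : lifted_dist theta q z z = 0.
Proof.
rewrite /lifted_dist /simplex_dist W_graph_refl; last exact: simplex_prob_graph_prob.
rewrite subrr (_ : enorm _ = 0%R); first by rewrite expe2 mule0 adde0 expr0n/= sqrtr0.
by rewrite /enorm big1 ?sqrtr0// => i _; rewrite mxE expr0n.
Qed.

Lemma D_graph_sym mu nu : D_graph theta q mu nu = D_graph theta q nu mu.
Proof.
have sub m1 m2 : [set w | exists l1 l2 : probability Z R,
    [/\ projects_to l1 m1, projects_to l2 m2 &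
        w = wasserstein2 (lifted_dist theta q) l1 l2]] `<=`
  [set w | exists l1 l2 : probability Z R,
    [/\ projects_to l1 m2, projects_to l2 m1 &
        w = wasserstein2 (lifted_dist theta q) l1 l2]].
  move=> _ [l1 [l2 [p1 p2 ->]]]; exists l2, l1; split => //.
  exact: wasserstein2_sym lifted_dist_sym.
by rewrite /D_graph; congr ereal_inf; apply/seteqP; split; exact: sub.
Qed.

Lemma D_graph_ge0 mu nu : 0 <= D_graph theta q mu nu.
Proof. by apply: le_ereal_inf_tmp => _ [l1 [l2 [_ _ ->]]]; exact: sqrte_ge0. Qed.

Lemma D_graph_le mu nu l1 l2 g : projects_to l1 mu -> projects_to l2 nu ->
  is_coupling l1 l2 g ->
  D_graph theta q mu nu <=
  sqrte (\int[g]_z (lifted_dist theta q z.1 z.2 ^+ 2)).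
Proof.
move=> p1 p2 gl; apply: (@le_trans _ _ (wasserstein2 (lifted_dist theta q) l1 l2)).
  by apply: ereal_inf_lbound; exists l1, l2.
exact: wasserstein2_le.
Qed.

(** A single lift projects to both vector measures, and its diagonal coupling has zero cost. *)
Lemma D_graph_eq0 mu nu : vector_prob mu ->
  (forall i (A : set X), measurable A -> mu i A = nu i A) ->
  D_graph theta q mu nu = 0.
Proof.
move=> hmu munu; have [l lE] := vertex_lift_exists hmu.
have [g gl gle] := coupling_diagonal l.
have pl := vertex_lift_projects_to lE.
apply/eqP; rewrite eq_le D_graph_ge0 andbT.
apply: (le_trans (D_graph_le pl (eq_projects_to munu pl) gl)).
rewrite -[leRHS](@sqrte0 R) lee_sqrt//.
apply: (le_trans (gle _ _)) => [z|]; first by rewrite sqre_ge0.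
by rewrite integral0_eq// => z _; rewrite lifted_dist_refl expe2 mule0.
Qed.

Lemma D_graph_lty mu nu : connected_graph q -> vector_prob2 mu ->
  vector_prob2 nu -> D_graph theta q mu nu < +oo.
Proof.
move=> hconn [mu1 mu2] [nu1 nu2].
have [C HC] := W_graph_sqr_le Htheta hq hsym hconn.
have [l1 l1E] := vertex_lift_exists mu1; have [l2 l2E] := vertex_lift_exists nu1.
have [g gl] := coupling_product l1 l2.
apply: (le_lt_trans (D_graph_le (vertex_lift_projects_to l1E)
  (vertex_lift_projects_to l2E) gl)).
pose e (z : Z) : \bar R := (enorm (z.1 : 'rV[R]_d) ^+ 2)%:E.
have e0 z : 0 <= e z by rewrite lee_fin sqr_ge0.
have me : measurable_fun [set: Z] e.
  apply/measurable_EFinP.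
  exact: (measurableT_comp (@enorm_sqr_measurable R d) measurable_fst).
have efin (m : vector_measure R d n) l : (forall i, \int[m i]_x (enorm (x : 'rV[R]_d) ^+ 2)%:E < +oo) ->
    vertex_lift m l -> \int[l]_z e z < +oo.
  move=> m2 lE; rewrite lE//; apply: lte_sum_pinfty => j _; exact: m2.
(* A measurable majorant of the cost whose integral reduces to second moments of the marginals. The
   absolute value keeps the constant nonnegative, as additivity of the integral requires here. *)
pose b (z : Z * Z) := e z.1 + e z.1 + (e z.2 + e z.2) + `|C|%:E.
have bint : \int[g]_z b z < +oo.
  have me1 : measurable_fun [set: Z * Z] (fun z : Z * Z => e z.1).
    exact: (measurableT_comp me measurable_fst).
  have me2 : measurable_fun [set: Z * Z] (fun z : Z * Z => e z.2).
    exact: (measurableT_comp me measurable_snd).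
  have intD (h1 h2 : Z * Z -> \bar R) : (forall z, 0 <= h1 z) ->
      (forall z, 0 <= h2 z) -> measurable_fun setT h1 -> measurable_fun setT h2 ->
      \int[g]_z (h1 z + h2 z) = \int[g]_z h1 z + \int[g]_z h2 z.
    by move=> h10 h20 mh1 mh2; rewrite ge0_integralD.
  have e10 (z : Z * Z) : 0 <= e z.1 + e z.1 by rewrite adde_ge0.
  have e20 (z : Z * Z) : 0 <= e z.2 + e z.2 by rewrite adde_ge0.
  have m11 := emeasurable_funD me1 me1; have m22 := emeasurable_funD me2 me2.
  have C0 (z : Z * Z) : 0 <= `|C|%:E by rewrite lee_fin.
  rewrite (intD _ _ (fun z => adde_ge0 (e10 z) (e20 z)) C0
    (emeasurable_funD m11 m22) (measurable_cst _)).
  rewrite (intD _ _ e10 e20 m11 m22) !intD//.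
  rewrite (coupling_integral_fst gl me) (coupling_integral_snd gl me).
  have -> : \int[g]_z `|C|%:E = `|C|%:E.
    apply: (eq_trans (integral_cst g measurableT _)).
    rewrite -[RHS]mule1; congr (_ * _).
    exact: probability_setT.
  have E1 := efin _ _ mu2 l1E; have E2 := efin _ _ nu2 l2E.
  apply: lte_add_pinfty; last by rewrite ltry.
  by apply: lte_add_pinfty; apply: lte_add_pinfty; (exact: E1 || exact: E2).
have cb : \int[g]_z (lifted_dist theta q z.1 z.2 ^+ 2) <= \int[g]_z b z.
  apply: ge0_le_lower_integral => z _; first by rewrite sqre_ge0.
  rewrite lifted_dist_sqr /b leeD//.
    by rewrite /e -!EFinD lee_fin enorm_sub_sqr_le.
  apply: (le_trans (HC _ _ (simplex_prob_graph_prob _) (simplex_prob_graph_prob _))).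
  by rewrite lee_fin ler_norm.
have i0 : 0 <= \int[g]_z (lifted_dist theta q z.1 z.2 ^+ 2).
  by apply: integral_ge0 => z _; rewrite sqre_ge0.
have := sqrte_fin_num i0; rewrite !ge0_fin_numE ?sqrte_ge0// => ->.
exact: le_lt_trans bint.
Qed.

(** * Lipschitz test functions along a coupling *)

Section lipschitz_estimate.
Variables (mu nu : vector_measure R d n) (l1 l2 : probability Z R)
  (g : probability (Z * Z)%type R).
Hypotheses (p1 : projects_to l1 mu) (p2 : projects_to l2 nu)
  (gl : is_coupling l1 l2 g).
Variables (j : 'I_n.+1) (eta : 'rV[R]_d -> R) (L : R).
Hypotheses (lip : lipschitz01 eta L).

Let Q : R := (1 + \sum_i \sum_j q i j)%R.
Let K : R := (4 * Q + L ^+ 2)%R.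
Let f (z : Z) : R := (simplex_prob z.2 0 j * eta z.1)%R.
Let dx (z : Z * Z) : R := enorm ((z.1.1 : 'rV[R]_d) - z.2.1).
Let dp (z : Z * Z) : R := (simplex_prob z.2.2 0 j - simplex_prob z.1.2 0 j)%R.
(** A measurable minorant of the squared lifted distance, through which all further integration
    goes. *)
Let m (z : Z * Z) : R := ((dp z ^+ 2 + L ^+ 2 * dx z ^+ 2) / K)%R.

Let Q0 : (0 < Q)%R.
Proof.
rewrite ltr_pwDl// sumr_ge0// => k _; rewrite sumr_ge0// => k' _; exact: hq.
Qed.

Let K0 : (0 < K)%R.
Proof. by rewrite ltr_pwDl ?sqr_ge0// mulr_gt0. Qed.

Let m_ge0 z : (0 <= m z)%R.
Proof.
by apply: divr_ge0 (ltW K0); apply: addr_ge0; [|apply: mulr_ge0]; exact: sqr_ge0.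
Qed.

(** As [K] is at least [L^2] and at least [4 Q], the spatial term is below the squared Euclidean
    distance and the other one below the squared graph metric. *)
Let m_le z : (m z)%:E <= lifted_dist theta q z.1 z.2 ^+ 2.
Proof.
rewrite lifted_dist_sqr /m mulrDl addrC EFinD leeD//.
  rewrite lee_fin ler_pdivrMr// mulrC ler_wpM2l ?sqr_ge0//.
  by rewrite /K lerDr mulr_ge0// ltW.
apply: le_trans (W_graph_sqr_ge _ _ j Htheta hq hsym).
rewrite lee_fin -/Q real_normK ?num_real// ler_wpM2l ?sqr_ge0//.
by rewrite lef_pV2 ?posrE ?mulr_gt0// /K lerDl sqr_ge0.
Qed.

Let ceta : continuous (eta : 'rV[R]_d -> R^o).
Proof. exact: lipschitz01_continuous lip. Qed.

Let beta : bounded_fun (eta : 'rV[R]_d -> R^o).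
Proof.
exists 1%R; split => // M M1 x _ /=; have [/(_ x)/andP[e0 e1] _] := lip.
by rewrite ger0_norm// (le_trans e1)// ltW.
Qed.

Let p01 (z : Z) : (0 <= simplex_prob z.2 0 j <= 1)%R.
Proof.
have [s0 s1] := simplex_prob_graph_prob z.2.
by rewrite s0/= -s1 (bigD1 j)//= lerDl sumr_ge0.
Qed.

Let f01 z : (0 <= f z <= 1)%R.
Proof.
have /andP[a0 a1] := p01 z; have [/(_ z.1)/andP[b0 b1] _] := lip.
by rewrite mulr_ge0//= mulr_ile1.
Qed.

Let mf : measurable_fun [set: Z] f.
Proof. exact: measurable_weighted. Qed.

Let bounded_integrable (h : Z * Z -> R) : measurable_fun setT h ->
  (forall z, 0 <= h z <= 1)%R -> g.-integrable setT (EFin \o h).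
Proof.
move=> mh h01; apply: measurable_bounded_integrable => //.
  exact: (le_lt_trans (probability_le1 g measurableT) (ltry 1)).
exists 1%R; split => // M M1 x _ /=; have /andP[e0 e1] := h01 x.
by rewrite ger0_norm// (le_trans e1)// ltW.
Qed.

Let mm : measurable_fun [set: Z * Z] m.
Proof.
have mp1 : measurable_fun [set: Z * Z] (fun z : Z * Z => simplex_prob z.1.2 0%R j).
  apply: (measurableT_comp (simplex_prob_measurable j)).
  exact: (measurableT_comp measurable_snd measurable_fst).
have mp2 : measurable_fun [set: Z * Z] (fun z : Z * Z => simplex_prob z.2.2 0%R j).
  apply: (measurableT_comp (simplex_prob_measurable j)).
  exact: (measurableT_comp measurable_snd measurable_snd).
apply: measurable_funM; last exact: measurable_cst.
apply: measurable_funD; first by apply: measurable_funX; exact: measurable_funB.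
apply: measurable_funM; first exact: measurable_cst.
rewrite (_ : (fun _ => _) = fun z : Z * Z =>
  (\sum_i ((z.1.1 : 'rV[R]_d) 0 i - (z.2.1 : 'rV[R]_d) 0 i) ^+ 2)%R); last first.
  by apply/funext => z; rewrite /dx enorm_sqr; apply: eq_bigr => i _; rewrite !mxE.
apply: measurable_sum => i; apply: measurable_funX; apply: measurable_funB.
  apply: (measurableT_comp (@coord_borel_measurable R d i)).
  exact: (measurableT_comp measurable_fst measurable_fst).
apply: (measurableT_comp (@coord_borel_measurable R d i)).
exact: (measurableT_comp measurable_fst measurable_snd).
Qed.

(** The difference of products splits into a variation of [eta], bounded by [|L dx|], and a
    variation of the weight, bounded by [|dp|]. Young's inequality costs [1 / a] for each. *)
Let f_young a z : (0 < a)%R ->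
  (`|f z.1 - f z.2| <= a * K * m z + 2 / a)%R.
Proof.
move=> a0.
have young x : (`|x| <= a * x ^+ 2 + a^-1)%R.
  have : (0 <= (a * `|x| - 1) ^+ 2 + (a * `|x|) ^+ 2 + 1)%R.
    by rewrite !addr_ge0 ?sqr_ge0.
  have : (0 <= (a * `|x| - 1) ^+ 2)%R by exact: sqr_ge0.
  have : (0 <= a * `|x|)%R by rewrite mulr_ge0// ltW.
  rewrite !sqrrB !exprMn real_normK ?num_real// mulr1 expr1n => *.
  rewrite -(ler_pM2l a0) mulrDr mulfV ?gt_eqF//; lra.
have -> : (a * K * m z = a * (dp z ^+ 2) + a * (L * dx z) ^+ 2)%R.
  by rewrite /m; field; rewrite gt_eqF.
have /andP[a1 a2] := p01 z.1; have [he hl] := lip.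
have /andP[b1 b2] := he z.2.1.
have -> : (f z.1 - f z.2 = simplex_prob z.1.2 0 j * (eta z.1.1 - eta z.2.1) -
    dp z * eta z.2.1)%R by rewrite /f /dp; ring.
have h1 : (`|simplex_prob z.1.2 0 j * (eta z.1.1 - eta z.2.1)| <= `|L * dx z|)%R.
  rewrite normrM ger0_norm//.
  apply: (@le_trans _ _ (1 * `|eta z.1.1 - eta z.2.1|))%R; first by rewrite ler_wpM2r.
  rewrite mul1r; apply: (le_trans (hl _ _)).
  apply: (le_trans (ler_wpM2r (normr_ge0 _) (ler_norm L))).
  by rewrite normrM ler_wpM2l// (le_trans (norm_le_enorm _))// ler_norm.
have h2 : (`|dp z * eta z.2.1| <= `|dp z|)%R.
  by rewrite normrM ler_piMr// ger0_norm.
apply: (le_trans (ler_normB _ _)).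
have := young (dp z); have := young (L * dx z)%R; lra.
Qed.

(** Projection and marginals turn the integrals of [eta] into those of [f z.1] and [f z.2] under the
    same coupling; [f_young] is then integrated. *)
Lemma lipschitz_coupling_estimate (a e : R) : (0 < a)%R ->
  \int[g]_z (lifted_dist theta q z.1 z.2 ^+ 2) <= e%:E ->
  (`|fine (\int[mu j]_x (eta x)%:E) - fine (\int[nu j]_x (eta x)%:E)| <=
    a * (4 * Q + L ^+ 2) * e + 2 / a)%R.
Proof.
move=> a0 ge; rewrite -/K.
have mI : \int[g]_z (m z)%:E <= e%:E.
  apply: le_trans ge; apply: ge0_le_lower_integral => z _; last exact: m_le.
  by rewrite lee_fin.
have im : g.-integrable setT (EFin \o m).
  apply/integrableP; split; first exact/measurable_EFinP.
  under eq_integral => z _ do rewrite gee0_abs ?lee_fin//.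
  by apply: (le_lt_trans mI); rewrite ltry.
have mf1 : measurable_fun [set: Z * Z] (fun z : Z * Z => f z.1).
  exact: (measurableT_comp mf measurable_fst).
have mf2 : measurable_fun [set: Z * Z] (fun z : Z * Z => f z.2).
  exact: (measurableT_comp mf measurable_snd).
have if1 := bounded_integrable mf1 (fun z => f01 z.1).
have if2 := bounded_integrable mf2 (fun z => f01 z.2).
have E1 : \int[mu j]_x (eta x)%:E = \int[g]_z (f z.1)%:E.
  rewrite (p1 j ceta beta) -(coupling_integral_fst gl)//.
  exact/measurable_EFinP.
have E2 : \int[nu j]_x (eta x)%:E = \int[g]_z (f z.2)%:E.
  rewrite (p2 j ceta beta) -(coupling_integral_snd gl)//.
  exact/measurable_EFinP.
rewrite E1 E2.
have RB := @RintegralB _ _ _ g setT _ _ measurableT if1 if2.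
rewrite /Rintegral in RB; rewrite -RB.
have iB : g.-integrable setT (EFin \o (fun z => f z.1 - f z.2)%R).
  rewrite (_ : _ \o _ = (EFin \o (fun z => f z.1)) \- (EFin \o (fun z => f z.2)))//.
  exact: integrableB.
apply: (le_trans (le_normr_Rintegral measurableT iB)).
have ic c : g.-integrable setT (EFin \o (fun=> c)).
  exact: (finite_measure_integrable_cst g c measurableT).
have iK : g.-integrable setT (EFin \o (fun z => a * K * m z)%R).
  exact: (integrableZl measurableT (a * K)%R im).
have iD : g.-integrable setT (EFin \o (fun z => a * K * m z + 2 / a)%R).
  rewrite (_ : _ \o _ = (EFin \o (fun z => a * K * m z)%R) \+ (EFin \o (fun=> 2 / a)%R))//.
  exact: integrableD.
apply: (@le_trans _ _ (\int[g]_z (a * K * m z + 2 / a))%R).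
  apply: le_Rintegral => //; first exact: integrable_norm iB.
  by move=> z _; exact: f_young.
have RC : (\int[g]_z (2 / a) = 2 / a)%R.
  apply: (eq_trans (Rintegral_cst g measurableT _)).
  rewrite -[RHS]mulr1; congr (_ * _)%R.
  exact: (congr1 fine (probability_setT g)).
rewrite RintegralD// RintegralZl// RC lerD2r ler_wpM2l//; first by rewrite mulr_ge0 ?ltW.
rewrite -lee_fin /Rintegral fineK//.
exact: integrable_fin_num.
Qed.

End lipschitz_estimate.

Lemma D_graph0_eq mu nu : D_graph theta q mu nu = 0 ->
  forall i (A : set X), measurable A -> mu i A = nu i A.
Proof.
move=> D0 j; apply: lipschitz_measure_unique => eta L lip.
have fin (m : {finite_measure set X -> \bar R}) :
    \int[m]_x (eta x)%:E \is a fin_num.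
  apply: integrable_fin_num => //; apply: measurable_bounded_integrable => //.
  - exact: fin_num_fun_lty.
  - apply: continuous_borel_measurable; exact: lipschitz01_continuous lip.
  - exists 1%R; split => // M M1 x _ /=; have [/(_ x)/andP[e0 e1] _] := lip.
    by rewrite ger0_norm// (le_trans e1)// ltW.
rewrite -[LHS]fineK// -[RHS]fineK//; congr EFin.
apply/eqP; rewrite -subr_eq0 -normr_le0; apply/ler_addgt0Pr => e e0; rewrite add0r.
pose K : R := (4 * (1 + \sum_i \sum_j q i j) + L ^+ 2)%R.
have K0 : (0 < K)%R.
  rewrite ltr_pwDl ?sqr_ge0// mulr_gt0// ltr_pwDl// sumr_ge0// => k _.
  by rewrite sumr_ge0.
(* The error [a K b + 2 / a] is to equal [e]: this [a] makes the second term [e / 2], and [b] is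
   chosen to make the first one [e / 2]. *)
pose a : R := (4 / e)%R; have a0 : (0 < a)%R by rewrite divr_gt0.
pose b : R := (e / 2 / (a * K))%R.
have b0 : (0 < b)%R by rewrite !divr_gt0// mulr_gt0.
(* A positive number with [c^2 <= b], so that a Wasserstein distance below [c] yields a coupling of
   cost at most [b]. *)
pose c : R := Num.min 1%R b; have c0 : (0 < c)%R by rewrite lt_min ltr01.
have cb : (c ^+ 2 <= b)%R.
  rewrite expr2 (@le_trans _ _ (1 * c)%R)//; last by rewrite mul1r ge_min lexx orbT.
  by rewrite ler_wpM2r ?(ltW c0)// ge_min lexx.
have : D_graph theta q mu nu < c%:E by rewrite D0 lte_fin.
move=> /ereal_inf_lt[_ [l1 [l2 [p1 p2 ->]]]] Wc.
set I := ereal_inf [set \int[g]_z (lifted_dist theta q z.1 z.2 ^+ 2)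
  | g in is_coupling l1 l2].
have I0 : 0 <= I.
  by apply: le_ereal_inf_tmp => _ [g _ <-]; apply: integral_ge0 => z _; rewrite sqre_ge0.
have : I < (c ^+ 2)%:E.
  rewrite ltNge; apply/negP => cI; move: Wc; rewrite ltNge => /negP; apply.
  have -> : c%:E = sqrte (c ^+ 2)%:E by rewrite /= sqrtr_sqr gtr0_norm.
  by rewrite /wasserstein2 -/I lee_sqrt.
move=> /ereal_inf_lt[_ [g gl <-]] gc.
have ge : \int[g]_z (lifted_dist theta q z.1 z.2 ^+ 2) <= b%:E.
  by apply: (le_trans (ltW gc)); rewrite lee_fin.
apply: (le_trans (lipschitz_coupling_estimate p1 p2 gl j lip a0 ge)).
rewrite -/K /b /a le_eqVlt; apply/orP; left; apply/eqP.
by field; rewrite !gt_eqF.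
Qed.

End lifted_distance.

Local Open Scope ereal_scope.

(** Equality of vector measures is read on Borel sets, since a measure is here a function on all
    sets whose other values are irrelevant. *)
Theorem proposition1p3 (R : realType) (d n : nat) (q : 'M[R]_n.+1)
    (theta : R -> R -> R)
    (hq : weighted_graph q) (hsym : symmetric_graph q)
    (hconn : connected_graph q) (htheta : interpolation_function theta)
    (mu nu : vector_measure R d n)
    (hmu : vector_prob2 mu) (hnu : vector_prob2 nu) :
  [/\ 0 <= D_graph theta q mu nu,
      D_graph theta q mu nu = D_graph theta q nu mu,
      D_graph theta q mu nu < +oo &
      D_graph theta q mu nu = 0 <->
      (forall i (A : set (borel 'rV[R]_d)), measurable A -> mu i A = nu i A)].
Proof.
split.
- exact: D_graph_ge0.
- exact: D_graph_sym.
- exact: D_graph_lty.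
- split; first exact: D_graph0_eq.
  by have [hmu1 _] := hmu; exact: D_graph_eq0.
Qed.
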